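(* Let $D\subset\mathbb{C}^n$ be a bounded smooth circular domain that is strongly star shaped with respect to the origin, and let $A\subset\partial D$ be a circular compact set. Then on $D$ $$\omega^n(\cdot,A,D)\le\omega^R(\cdot,A,D)=\omega^c(\cdot,A,D).$$ In particular, for all $z\in D$, $$\omega^c(z,A,D)=\omega(z,A,D)=\omega^n(z,A,D).$$
   Context: A set $E\subset\mathbb{C}^n$ is circular if $e^{i\theta}z\in E$ for all $z\in E$ and $\theta\in\mathbb{R}$. A domain is smooth if it has smooth boundary. A domain $D$ is strongly star shaped with respect to the origin if $r\overline D\subset D$ for all $r\in\,]0,1[$. $\mathrm{PSH}(D)^-$ denotes the family of non-positive plurisubharmonic functions on $D$. For $u\in\mathrm{PSH}(D)^-$ and $z\in\overline D$, $u^*(z)=\limsup_{\zeta\to z,\ \zeta\in D}u(\zeta)$. For $A\subset\partial D$ and $z\in D$, the boundary relative extremal functions are: - $\omega^c(z,A,D)=\sup\{u(z): u\in\mathrm{PSH}(D)^-\cap C(\overline D),\ u\le -1 \text{ on } A\}$; - $\omega(z,A,D)=\sup\{u(z): u\in\mathrm{PSH}(D)^-,\ u^*\le -1 \text{ on } A\}$; - $\omega^n(z,A,D)=\sup\{u(z): u\in\mathrm{PSH}(D)^-,\ \limsup_{y\to\zeta,\ y\in n_\zeta}u(y)\le -1 \text{ for all }\zeta\in A\}$, where $n_\zeta$ is the inward normal to $\partial D$ at $\zeta$; - $\omega^R(z,A,D)=\sup\{u(z): u\in\mathrm{PSH}(D)^-,\ \limsup_{r\to1^-}u(r\zeta)\le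 -1 \text{ for all }\zeta\in A\}$. Here the superscript $n$ in $\omega^n$ stands for ''normal'' and is not the dimension. *)

(* Defs.v *)
From HB Require Import structures.
From mathcomp Require Import all_boot all_order all_algebra.
From mathcomp Require Import complex.
From mathcomp Require Import all_classical all_reals all_analysis.

Set Implicit Arguments.
Unset Strict Implicit.
Unset Printing Implicit Defensive.

Import Order.TTheory GRing.Theory Num.Theory numFieldNormedType.Exports.

Local Open Scope classical_set_scope.
Local Open Scope ring_scope.
Local Open Scope complex_scope.

(* [R[i]] carries no topology of its own; its regular algebra [R[i]^o] does, *)
(* with the norm [`|z| : R[i]] (a nonnegative real complex number).          *)
Notation Cn R n := 'rV[R[i]^o]_n.

Section Domains.
Variables (R : realType) (n : nat).
Implicit Types (D E U : set (Cn R n)) (rho : Cn R n -> R) (z v : Cn R n).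

Definition expi (t : R) : R[i] := cos t +i* sin t.

Definition circular E := forall (t : R) z, E z -> E (expi t *: z).

Definition domain D := [/\ open D, connected D & D !=set0].

Definition strongly_star_shaped D :=
  forall r : R, 0 < r < 1 -> forall z, closure D z -> D (r%:C *: z).

Definition boundary D := closure D `\` D°.

(* Real directional derivatives of a real-valued function: C^n is seen as    *)
(* R^(2n), the direction [v] being an arbitrary complex vector.              *)
Definition ddir v rho z : R := derive1 (fun t : R => rho (z + t%:C *: v)) 0.

Definition ddirable v rho z := derivable (fun t : R => rho (z + t%:C *: v)) 0 1.

Fixpoint of_class_C (k : nat) U rho : Prop :=
  (forall z, U z -> {for z, continuous rho}) /\
  if k is k'.+1 then
    forall v, (forall z, U z -> ddirable v rho z) /\
              of_class_C k' U (ddir v rho)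
  else True.

Definition smooth_on U rho := forall k, of_class_C k U rho.

(* The gradient of R^(2n), the j-th entry being d rho/dx_j + i d rho/dy_j.   *)
Definition grad rho z : Cn R n :=
  \row_j (ddir (delta_mx 0 j) rho z +i* ddir ('i *: delta_mx 0 j) rho z).

Definition local_defining_function D z U rho :=
  [/\ open U, U z, smooth_on U rho,
      forall w, U w -> grad rho w != 0 &
      D `&` U = [set w | U w /\ rho w < 0]].

Definition smooth_boundary D :=
  forall z, boundary D z -> exists U rho, local_defining_function D z U rho.

(* The open half-line of direction [- grad rho z] issued from [z]; the       *)
(* gradients at [z] of two local defining functions are positively           *)
(* proportional, so that the half-line does not depend on [rho].             *)
Definition inward_normal D z : set (Cn R n) :=
  [set y | exists U rho (t : R), [/\ local_defining_function D z U rho,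
                                     0 < t & y = z - t%:C *: grad rho z]].

End Domains.

Section Plurisubharmonic.
Variable R : realType.
Local Open Scope ereal_scope.

Definition usc_on (T : topologicalType) (D : set T) (u : T -> \bar R) :=
  forall z, D z -> forall a : R, u z < a%:E ->
    \forall w \near within D (nbhs z), u w < a%:E.

(* The function that is identically -oo is allowed. The positive part of the *)
(* integrand is bounded by semicontinuity, so that the integral is an        *)
(* element of [-oo, +oo[.                                                    *)
Definition subharmonic (U : set R[i]^o) (v : R[i]^o -> \bar R) :=
  [/\ forall w, U w -> v w < +oo, usc_on U v &
      forall (c : R[i]^o) (r : R), (0 < r)%R ->
        (forall w, (`|w - c| <= r%:C)%R -> U w) ->
        v c <= ((2 * pi)^-1)%:E *
               \int[lebesgue_measure]_(t in `[0%R, (2 * pi)%R])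
                  v (c + r%:C * expi t)%R].

Variable n : nat.
Implicit Types (D A : set (Cn R n)) (u : Cn R n -> \bar R) (z : Cn R n).

Definition psh D u :=
  [/\ forall z, D z -> u z < +oo, usc_on D u &
      forall a b : Cn R n,
        subharmonic [set w | D (a + w *: b)%R] (fun w => u (a + w *: b)%R)].

Definition psh_neg D u := psh D u /\ forall z, D z -> u z <= 0.

Definition limsup_in D u z : \bar R := limf_esup u (within D (nbhs z)).

Definition omega_c A D z : \bar R :=
  ereal_sup [set (u z)%:E | u in [set u : Cn R n -> R |
    [/\ psh_neg D (fun w => (u w)%:E), {within closure D, continuous u} &
        forall x, A x -> (u x <= - 1)%R]]].

Definition omega A D z : \bar R :=
  ereal_sup [set u z | u in [set u | psh_neg D u /\
    forall x, A x -> limsup_in D u x <= (- 1)%:E]].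

Definition omega_n A D z : \bar R :=
  ereal_sup [set u z | u in [set u | psh_neg D u /\
    forall x, A x -> limsup_in (inward_normal D x `&` D) u x <= (- 1)%:E]].

Definition omega_R A D z : \bar R :=
  ereal_sup [set u z | u in [set u | psh_neg D u /\
    forall x, A x ->
      limf_esup (fun r : R => u (r%:C *: x)%R) 1^'- <= (- 1)%:E]].

End Plurisubharmonic.

(* Main.v *)
Require Import Defs.
From HB Require Import structures.
From mathcomp Require Import all_boot all_order all_algebra.
From mathcomp Require Import complex.
From mathcomp Require Import all_classical all_reals all_analysis.
From mathcomp Require Import measurable_realfun ring lra.

Import Order.TTheory GRing.Theory Num.Theory numFieldNormedType.Exports.

(* The inequalities omega_c <= omega <= omega_n and omega <= omega_R are immediate, so it
   suffices to bound by omega_c any nonpositive psh u whose radial or normal boundary limits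
   on A are at most -1; replace u by max(u, -1).

   1. Let zeta in A and let v be the direction (radial or inward normal) of the limits. For
      small t > 0 the closed disc {l (zeta + t v) : |l| <= 1} lies in D. By dominated
      convergence the mean of u + 1 over its boundary circle tends to 0 with t, hence, by a
      Harnack inequality, so does u (s (zeta + t v)) + 1 for every |s| < 1. A half-line is not
      thin at its endpoint, so that u (s zeta) <= -1 as well (t = 0).

   2. By step 1 the dilation u (l .), |l| < 1, is psh in a neighbourhood of the closure of D and
      is at most -1 on A. Its sup-convolution y |-> sup_x (u (l x) - k |x - y|) is Lipschitz,
      is psh as a supremum of translates of psh functions, and for large k is at most -1 + e on
      A; subtracting e gives a competitor for omega_c. Hence u (l z) <= omega_c z.

   3. Applying the submean inequality to a small circle centred at a maximum point of
      l |-> u (l z) on the closed unit disc, a fixed part of which is inside the disc, one lets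
      |l| -> 1 in step 2. *)

Set Implicit Arguments.
Unset Strict Implicit.
Unset Printing Implicit Defensive.

Local Open Scope classical_set_scope.
Local Open Scope ring_scope.
Local Open Scope complex_scope.

(** Upper semicontinuity points the wrong way at both passages to the limit, t -> 0 in step 1 and
    |l| -> 1 in step 3: it leaves room for [u] to jump up at the limit point. Both jumps are
    excluded by the same contradiction: around a suitable point the function barely exceeds its
    value there, on a fixed fraction of a small circle it is lower by a fixed amount, and the circle
    mean becomes too small. Circularity of [A] and [D] makes step 1 possible: the boundary circle of
    the disc through zeta + t v approaches the whole orbit e^{i theta} zeta, and rotations preserve
    [A], the radii and the inward normals, so that the limits hold for each theta. Truncation at -1
    gives real-valued functions with uniform bounds, hence finite circle means and a constant
    dominating function. Sup-convolution is the regularisation because its submean inequality comes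
    from one-variable means alone; it also supplies the Lipschitz functions for the discretised
    Harnack inequality. The constants are explicit but far from sharp. *)

Section CircleMean.

(** * Integrals over segments and means over the circle *)

Variable R : realType.
Implicit Types (f g : R -> R) (a b t x : R).
Notation mu := (@lebesgue_measure R).

Definition bounded_measurable a b f :=
  measurable_fun `[a, b] f /\ exists M, forall t, `[a, b]%classic t -> `|f t| <= M.

Lemma bounded_measurable_integrable a b f :
  bounded_measurable a b f -> mu.-integrable `[a, b] (EFin \o f).
Proof.
move=> [mf [M fM]]; apply: measurable_bounded_integrable => //.
  by rewrite /= lebesgue_measure_itv /=; case: ifP => // _; rewrite -EFinD ltry.
exists M; split; first exact: num_real.
by move=> N MN t /= tab; rewrite (le_trans (fM t tab))// ltW.
Qed.

Lemma bounded_measurable_cst a b x : bounded_measurable a b (fun=> x).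
Proof. by split; [exact: measurable_cst | exists `|x|]. Qed.

Lemma bounded_measurableD a b f g :
  bounded_measurable a b f -> bounded_measurable a b g ->
  bounded_measurable a b (fun t => f t + g t).
Proof.
move=> [mf [M fM]] [mg [N gN]]; split; first exact: measurable_funD.
exists (M + N) => t tab.
by rewrite (le_trans (ler_normD _ _))// lerD ?fM ?gN.
Qed.

Lemma bounded_measurable_continuous a b f :
  continuous f -> bounded_measurable a b f.
Proof.
move=> cf; split; first by apply: measurable_funS (continuous_measurable_fun cf).
have /compact_bounded[M [_ fM]] : compact (f @` `[a, b]).
  by apply: continuous_compact; [exact: continuous_subspaceT|exact: segment_compact].
by exists (`|M| + 1) => t tab; apply: fM; [rewrite ltr_pwDr// ler_norm|exists t].
Qed.

Lemma bounded_measurableS a b c d f : a <= c -> d <= b ->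
  bounded_measurable a b f -> bounded_measurable c d f.
Proof.
move=> ac db [mf [M fM]].
have sub : `[c, d] `<=` `[a, b] by apply: subset_itv; rewrite bnd_simp.
split; first exact: measurable_funS mf.
by exists M => t /sub; exact: fM.
Qed.

Lemma Rintegral_split a b c f : a <= c <= b -> bounded_measurable a b f ->
  \int[mu]_(t in `[a, b]) f t =
  \int[mu]_(t in `[a, c]) f t + \int[mu]_(t in `[c, b]) f t.
Proof.
move=> /andP[ac cb] fb.
have := @Rintegral_itvB _ f (BLeft a) (BRight b) c
  (bounded_measurable_integrable fb).
rewrite !bnd_simp ac cb => /(_ isT isT).
rewrite Rintegral_itv_obnd_cbnd => [<-|]; first by rewrite addrC subrK.
apply: integrableS (bounded_measurable_integrable fb) => //.
by apply: subset_itv; rewrite bnd_simp.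
Qed.

Lemma Rintegral_itv_cst a b x : a <= b -> \int[mu]_(t in `[a, b]) x = x * (b - a).
Proof.
move=> ab; rewrite Rintegral_cst//= lebesgue_measure_itv /= lte_fin.
case: ltP => //= ba; have -> : a = b by apply/eqP; rewrite eq_le ab ba.
by rewrite subrr mulr0.
Qed.

Lemma le_Rintegral_itv a b f g : bounded_measurable a b f ->
  bounded_measurable a b g -> (forall t, a <= t <= b -> f t <= g t) ->
  \int[mu]_(t in `[a, b]) f t <= \int[mu]_(t in `[a, b]) g t.
Proof.
move=> bf bg fg; apply: le_Rintegral; [by []|exact: bounded_measurable_integrable..|].
by move=> t /=; rewrite in_itv; exact: fg.
Qed.

(** On every interval of length [T] some value of [f] is at most its mean there plus [e], for
    otherwise the integral would be too large. These points become the angles of the Cauchy kernels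
    in [harnack_bound], where the sum of the samples has to stay below the integral. *)
Lemma sample_points (T e : R) f N : 0 < T -> 0 < e ->
  bounded_measurable 0 (T *+ N) f ->
  exists a : nat -> R, (forall k, (k < N)%N -> T *+ k <= a k <= T *+ k.+1) /\
    T * \sum_(k < N) f (a k) <=
    \int[mu]_(t in `[0, T *+ N]) f t + T * e *+ N.
Proof.
move=> T0 e0; elim: N => [|N IH] fb.
  exists (fun=> 0); split => //.
  by rewrite big_ord0 mulr0 !mulr0n set_itv1 Rintegral_set1 addr0.
have TN : 0 <= T *+ N by rewrite mulrn_wge0// ltW.
have TNS : T *+ N <= T *+ N.+1 by rewrite mulrS lerDr ltW.
have [] := IH; first by apply: bounded_measurableS fb.
move=> a [aP sa].
have fb' : bounded_measurable (T *+ N) (T *+ N.+1) f by apply: bounded_measurableS fb.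
set J := \int[mu]_(t in `[T *+ N, T *+ N.+1]) f t.
have [x [xI fx]] : exists x, T *+ N <= x <= T *+ N.+1 /\ f x <= J / T + e.
  apply: contrapT => nex.
  have h t : T *+ N <= t <= T *+ N.+1 -> J / T + e <= f t.
    move=> tI; rewrite leNgt; apply/negP => ft; apply: nex; exists t.
    by split => //; exact: ltW.
  have := le_Rintegral_itv (bounded_measurable_cst _ _ _) fb' h.
  rewrite Rintegral_itv_cst// -/J mulrSr addrAC subrr add0r mulrDl divfK ?gt_eqF//.
  by rewrite gerDl; apply/negP; rewrite -ltNge mulr_gt0.
exists (fun k => if (k < N)%N then a k else x); split.
  move=> k; rewrite ltnS leq_eqVlt => /predU1P[->|kN]; first by rewrite ltnn.
  by rewrite kN; exact: aP.
rewrite big_ord_recr /= ltnn (eq_bigr (fun k : 'I_N => f (a k))); last first.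
  by move=> k _; rewrite ltn_ord.
rewrite (@Rintegral_split _ _ (T *+ N) _ _ fb); last by rewrite TN TNS.
rewrite -/J mulrDr mulrSr.
have : T * f x <= J + T * e.
  rewrite (le_trans (ler_wpM2l (ltW T0) fx))// mulrDr mulrC divfK ?gt_eqF//.
lra.
Qed.

Definition cmean f : R := (2 * pi)^-1 * \int[mu]_(t in `[0, 2 * pi]) f t.

Notation circ_bm := (bounded_measurable 0 (2 * pi)).

Lemma pi2_gt0 : 0 < 2 * pi :> R. Proof. by rewrite mulr_gt0// pi_gt0. Qed.

Lemma pi_lt4 : pi < 4 :> R.
Proof. by have := pihalf_lt2 R; rewrite ltr_pdivrMr// -natrM. Qed.

Lemma cmean_cst x : cmean (fun=> x) = x.
Proof.
by rewrite /cmean Rintegral_itv_cst ?ltW ?pi2_gt0// subr0 mulrC mulfK// gt_eqF ?pi2_gt0.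
Qed.

Lemma cmeanD f g : circ_bm f -> circ_bm g ->
  cmean (fun t => f t + g t) = cmean f + cmean g.
Proof.
move=> bf bg; rewrite /cmean RintegralD; [exact: mulrDr|by []|..];
exact: bounded_measurable_integrable.
Qed.

Lemma le_cmean f g : circ_bm f -> circ_bm g ->
  (forall t, 0 <= t <= 2 * pi -> f t <= g t) -> cmean f <= cmean g.
Proof.
move=> bf bg fg; rewrite ler_wpM2l//; first by rewrite invr_ge0 ltW ?pi2_gt0.
exact: le_Rintegral_itv.
Qed.

Lemma cmean_derivative (f F : R -> R) : continuous f ->
  (forall t : R, is_derive t 1 F (f t)) -> F (2 * pi) = F 0 -> cmean f = 0.
Proof.
move=> cf dF F2; rewrite /cmean /Rintegral (@continuous_FTC2 _ f F) ?pi2_gt0//.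
- by rewrite F2 -EFinB subrr mulr0.
- exact: continuous_subspaceT.
- split.
  + by move=> t _; have /@ex_derive := dF t.
  + apply: cvg_at_right_filter; apply: differentiable_continuous.
    by apply/derivable1_diffP; have /@ex_derive := dF 0.
  + apply: cvg_at_left_filter; apply: differentiable_continuous.
    by apply/derivable1_diffP; have /@ex_derive := dF (2 * pi).
- by move=> t _; rewrite derive1E; have /@derive_val := dF t.
Qed.

(** The real part of A + (a + i b) e^{it} + (c + i d) e^{2it}, which is the shape of a second-order
    expansion restricted to a circle. *)
Definition trig2 (A a b c d : R) t : R := A + (a * cos t - b * sin t) +
  (c * (cos t ^+ 2 - sin t ^+ 2) - d * (2 * (cos t * sin t))).

Lemma trig2_continuous (A a b c d : R) : continuous (trig2 A a b c d).
Proof.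
have cC := @continuous_cos R; have cS := @continuous_sin R.
have cM (g h : R -> R) : continuous g -> continuous h -> continuous (fun t => g t * h t).
  by move=> cg ch t; apply: continuousM; [exact: cg|exact: ch].
have cK (k : R) : continuous (fun _ : R => k) by move=> t; exact: cvg_cst.
have cB (g h : R -> R) : continuous g -> continuous h -> continuous (fun t => g t - h t).
  by move=> cg ch t; apply: continuousB; [exact: cg|exact: ch].
have cD (g h : R -> R) : continuous g -> continuous h -> continuous (fun t => g t + h t).
  by move=> cg ch t; apply: continuousD; [exact: cg|exact: ch].
apply: (cD (fun t => A + (a * cos t - b * sin t)) (fun t => c * _ - d * _)).
  apply: (cD (fun=> A) (fun t => a * cos t - b * sin t)) => //.
  by apply: (cB (fun t => a * cos t) (fun t => b * sin t)); apply: (cM _ _).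
apply: (cB (fun t => c * _) (fun t => d * _)); apply: (cM _ _) => //.
  by apply: (cB (fun t => cos t ^+ 2) (fun t => sin t ^+ 2)); apply: (cM _ _).
by apply: (cM _ _) => //; exact: (cM _ _).
Qed.

Lemma cmean_trig2 (A a b c d : R) : cmean (trig2 A a b c d) = A.
Proof.
have -> : trig2 A a b c d = (fun t => A + trig2 0 a b c d t).
  by apply/funext => t; rewrite /trig2 add0r -addrA.
rewrite (@cmeanD (fun=> A)); [|exact: bounded_measurable_cst|
  apply: bounded_measurable_continuous; exact: trig2_continuous].
suff -> : cmean (trig2 0 a b c d) = 0 by rewrite cmean_cst addr0.
(* A 2 pi-periodic primitive of the part without constant term. *)
apply: (@cmean_derivative _ (fun t => a * sin t + b * cos t +
  (c * (sin t * cos t) - d * sin t ^+ 2))); first exact: trig2_continuous.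
  by move=> t; apply: is_derive_eq; rewrite /trig2 /GRing.scale /=; ring.
by rewrite mulr_natl sin2pi cos2pi sin0 cos0; ring.
Qed.

(** Cutting the circle at [t0] and [t1]: a better bound [M'] on one arc lowers the mean in
    proportion to the length of the arc. This drives the contradictions in [slit_bound] and
    [bpsh_radial_le]. *)
Lemma cmean_arc f (M M' t0 t1 : R) : circ_bm f ->
  0 <= t0 -> t0 <= t1 -> t1 <= 2 * pi ->
  (forall t, 0 <= t <= 2 * pi -> f t <= M) ->
  (forall t, t0 <= t <= t1 -> f t <= M') ->
  cmean f <= M - (M - M') * ((t1 - t0) / (2 * pi)).
Proof.
move=> bf t00 t01 t12 fM fM'.
have p0 := pi2_gt0; rewrite /cmean -(ler_pM2l p0) mulVKf ?gt_eqF//.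
have b1 : bounded_measurable t0 (2 * pi) f by apply: bounded_measurableS bf.
rewrite (@Rintegral_split _ _ t0 _ _ bf); last by rewrite t00 (le_trans t01).
rewrite (@Rintegral_split _ _ t1 _ _ b1); last by rewrite t01.
have h u v K : 0 <= u -> u <= v -> v <= 2 * pi -> (forall t, u <= t <= v -> f t <= K) ->
    \int[mu]_(t in `[u, v]) f t <= K * (v - u).
  move=> u0 uv v2 fK; rewrite -Rintegral_itv_cst//.
  apply: le_Rintegral_itv fK; first by apply: bounded_measurableS bf.
  exact: bounded_measurable_cst.
have h1 := h 0 t0 M (lexx _) t00 (le_trans t01 t12).
have h2 := h t0 t1 M' t00 t01 t12 fM'.
have h3 := h t1 (2 * pi) M (le_trans t00 t01) t12 (lexx _).
have {}h1 : \int[mu]_(t in `[0, t0]) f t <= M * (t0 - 0).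
  apply: h1 => t /andP[x0 x1]; apply: fM; rewrite x0 /=.
  by rewrite (le_trans x1)// (le_trans t01).
have {}h3 : \int[mu]_(t in `[t1, 2 * pi]) f t <= M * (2 * pi - t1).
  apply: h3 => t /andP[x0 x1]; apply: fM; rewrite x1 andbT.
  by rewrite (le_trans _ x0)// (le_trans t00).
have -> : 2 * pi * (M - (M - M') * ((t1 - t0) / (2 * pi))) =
   2 * pi * M - (M - M') * (t1 - t0).
  by rewrite mulrBr (mulrC (2 * pi) (_ * _)) -mulrA divfK ?gt_eqF.
lra.
Qed.

Lemma cmean_cvg (f_ : nat -> R -> R) f (M : R) :
  (forall n, circ_bm (f_ n)) -> circ_bm f ->
  (forall n t, 0 <= t <= 2 * pi -> `|f_ n t| <= M) ->
  (forall t, 0 <= t <= 2 * pi -> f_ n t @[n --> \oo] --> f t) ->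
  cmean (f_ n) @[n --> \oo] --> cmean f.
Proof.
move=> bf_ bf fM ff; apply: cvgMr.
have [//||||||_ _ h] := @dominated_convergence _ _ _ mu `[0, 2 * pi] _
  (fun n => EFin \o f_ n) (EFin \o f) (EFin \o (fun=> M)).
- by move=> n; apply/measurable_EFinP; case: (bf_ n).
- by apply/measurable_EFinP; case: bf.
- apply: aeW => t /=; rewrite in_itv /= => tI.
  by apply: cvg_EFin; [exact: nearW|exact: ff].
- exact/bounded_measurable_integrable/bounded_measurable_cst.
- by apply: aeW => t n /=; rewrite in_itv /= => tI; rewrite lee_fin fM.
apply: fine_cvg; rewrite fineK//.
exact/integrable_fin_num/bounded_measurable_integrable.
Qed.

End CircleMean.

(** The superlevel sets of [W] in [K] are totally ordered by inclusion, hence a filter base; at a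
    cluster point [c] of it, semicontinuity excludes any value above [W c]. *)
Lemma usc_compact_max (R : realType) (T : topologicalType) (K : set T) (W : T -> R) :
  compact K -> K !=set0 ->
  (forall z, K z -> forall a, W z < a -> \forall y \near z, K y -> W y < a) ->
  exists2 c, K c & forall y, K y -> W y <= W c.
Proof.
move=> cK [z0 Kz0] uW.
pose F := filter_from K (fun y => K `&` [set x | W y <= W x]).
have FF : ProperFilter F.
  apply: filter_from_proper; last by move=> y Ky; exists y; split => //=.
  apply: filter_from_filter; first by exists z0.
  move=> y1 y2 K1 K2; case: (leP (W y1) (W y2)) => h.
    exists y2 => // x [Kx /= hx]; split; split => //=; exact: le_trans hx.
  exists y1 => // x [Kx /= hx]; split; split => //=; apply: le_trans hx; exact: ltW.
have FK : F K by exists z0 => // x [].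
have [c [Kc clc]] := cK F FF FK.
exists c => // y Ky; rewrite leNgt; apply/negP => cy.
have Fy : F (K `&` [set x | W y <= W x]) by exists y.
have [x [[Kx /= yx] /(_ Kx)]] := clc _ _ Fy (uW c Kc _ cy).
by rewrite ltNge yx.
Qed.

(** * Real-valued norms on complex normed spaces, and compactness *)

Section RealNorm.
Variables (R : realType).
Implicit Types V : normedModType R[i].

Lemma cReD (x y : R[i]) : complex.Re (x + y) = complex.Re x + complex.Re y.
Proof. by case: x; case: y. Qed.

Lemma cReM (x y : R[i]) : complex.Re (x * y) =
  complex.Re x * complex.Re y - complex.Im x * complex.Im y.
Proof. by case: x; case: y. Qed.

(* Norms over R[i] are R[i]-valued; their imaginary part is 0. *)
Definition rnorm V (z : V) : R := complex.Re `|z|.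

Lemma rnormE V (z : V) : `|z| = (rnorm z)%:C.
Proof.
rewrite /rnorm; have := normr_ge0 z; rewrite lecE /=.
by case: `|z| => a b /= /andP[/eqP ->].
Qed.

Variable V : normedModType R[i].
Implicit Types (a x y z : V) (l : R[i]^o).

Lemma rnorm_ge0 z : 0 <= rnorm z.
Proof. by have := normr_ge0 z; rewrite lecE => /andP[]. Qed.

Lemma rnormD x y : rnorm (x + y) <= rnorm x + rnorm y.
Proof. by have := ler_normD x y; rewrite lecE => /andP[_]; rewrite cReD. Qed.

Lemma rnormN x : rnorm (- x) = rnorm x.
Proof. by rewrite /rnorm normrN. Qed.

Lemma rnorm0 : rnorm (0 : V) = 0.
Proof. by rewrite /rnorm normr0. Qed.

Lemma rdistC x y : rnorm (x - y) = rnorm (y - x).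
Proof. by rewrite -rnormN opprB. Qed.

Lemma rnormZ l x : rnorm (l *: x) = rnorm l * rnorm x.
Proof.
apply: complexI; rewrite rmorphM /= -!rnormE; exact: normrZ.
Qed.

Lemma rdist_triangle z x y : rnorm (x - y) <= rnorm (x - z) + rnorm (z - y).
Proof. by rewrite -[x - y](subrKA z); exact: rnormD. Qed.

Lemma nbhs_rnormP z (P : set V) :
  (\forall y \near z, P y) <->
  exists2 e : R, 0 < e & forall y, rnorm (y - z) < e -> P y.
Proof.
split=> [/nbhs_normP[e /= e0 h]|[e e0 h]].
  have eE : e = (complex.Re e)%:C.
    by move: e0; rewrite ltcE /=; case: e {h} => a b /= /andP[/eqP ->].
  exists (complex.Re e); first by move: e0; rewrite eE ltcR.
  by move=> y yz; apply: h; rewrite /= distrC eE rnormE ltcR.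
apply/nbhs_normP; exists e%:C; first by rewrite /= ltcR.
by move=> y; rewrite /= distrC rnormE ltcR; exact: h.
Qed.

Lemma rdist_continuous a : continuous (fun z : V => rnorm (z - a)).
Proof.
move=> x A /= /nbhs_ballP[e /= e0 eA].
suff : \forall y \near x, A (rnorm (y - a)) by [].
apply/nbhs_rnormP; exists e => // y yx.
apply: eA; rewrite /ball /= distrC; apply: le_lt_trans yx.
have h1 := rdist_triangle x y a; have := rdist_triangle y x a; rewrite (rdistC x y) => h2.
by rewrite ler_norml; lra.
Qed.

Lemma rnorm_continuous : continuous (@rnorm V).
Proof.
have := @rdist_continuous 0; rewrite (_ : (fun z => rnorm (z - 0)) = @rnorm V)//.
by apply/funext => z; rewrite subr0.
Qed.

(** Near coverings make the radius uniform over [K]: half of the local radius absorbs the move of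
    [z], the other half the distance from [z] to [y]. *)
Lemma compact_thicken (K : set V) (O : set V) : compact K ->
  (forall z, K z -> \forall y \near z, O y) ->
  exists2 d : R, 0 < d & forall z y, K z -> rnorm (y - z) <= d -> O y.
Proof.
move=> cK KO; have /compact_near_coveringP cov := cK.
have : \forall d \near 0^'+, K `<=` (fun z => forall y, rnorm (y - z) <= d -> O y).
  apply: cov => z /KO /nbhs_rnormP[e e0 he].
  exists ([set y | rnorm (y - z) < e / 2], [set d | d < e / 2]).
    split => /=; last by apply: nbhs_right_lt; rewrite divr_gt0.
    by apply/nbhs_rnormP; exists (e / 2) => //; rewrite divr_gt0.
  move=> [x d] /= [xz de] y yx; apply: he.
  by rewrite (le_lt_trans (rdist_triangle x _ _))//; lra.
move=> near_d.
have [d [d0 Kd]] : exists d : R, 0 < d /\ K `<=` (fun z => forall y, rnorm (y - z) <= d -> O y).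
  near (0 : R)^'+ => d; exists d; split; first by near: d; exact: nbhs_right_gt.
  by near: d.
by exists d => // z y Kz; exact: Kd.
Unshelve. all: by end_near. Qed.

End RealNorm.

Section ComplexPlane.
Variable R : realType.
Implicit Types (z w l : R[i]^o) (r t : R).

Lemma rnorm_complexE z : rnorm z = Num.sqrt (complex.Re z ^+ 2 + complex.Im z ^+ 2).
Proof. by apply: complexI; rewrite -rnormE normc_def. Qed.

Lemma rnorm_sqr z : rnorm z ^+ 2 = complex.Re z ^+ 2 + complex.Im z ^+ 2.
Proof. by rewrite rnorm_complexE sqr_sqrtr// addr_ge0// sqr_ge0. Qed.

Lemma rnormM z w : rnorm (z * w : R[i]^o) = rnorm z * rnorm w.
Proof. exact: (@rnormZ R R[i]^o z w). Qed.

Lemma rnorm_real r : rnorm (r%:C : R[i]^o) = `|r|.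
Proof. by rewrite rnorm_complexE /= expr0n addr0 sqrtr_sqr. Qed.

Lemma abs_Re_le z : `|complex.Re z| <= rnorm z.
Proof.
rewrite -(ler_pXn2r (n := 2)) ?nnegrE ?rnorm_ge0// real_normK ?num_real//.
by rewrite rnorm_sqr lerDl sqr_ge0.
Qed.

Lemma abs_Im_le z : `|complex.Im z| <= rnorm z.
Proof.
rewrite -(ler_pXn2r (n := 2)) ?nnegrE ?rnorm_ge0// real_normK ?num_real//.
by rewrite rnorm_sqr lerDr sqr_ge0.
Qed.

Lemma rnorm_le_ReIm z : rnorm z <= `|complex.Re z| + `|complex.Im z|.
Proof.
rewrite -(ler_pXn2r (n := 2)) ?nnegrE ?rnorm_ge0 ?addr_ge0// rnorm_sqr.
rewrite sqrrD !real_normK ?num_real// lerD2r lerDl mulrn_wge0// mulr_ge0//.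
Qed.

Lemma rnorm_expi t : rnorm (expi t : R[i]^o) = 1.
Proof. by rewrite rnorm_complexE /= cos2Dsin2 sqrtr1. Qed.

Lemma expi0 : expi (0 : R) = 1.
Proof. by rewrite /expi cos0 sin0. Qed.

Lemma expiD (s t : R) : expi (s + t) = expi s * expi t.
Proof. by rewrite /expi cosD sinD /GRing.mul /=; congr (_ +i* _); rewrite addrC. Qed.

Lemma expiNK (t : R) : expi (- t) * expi t = 1.
Proof. by rewrite -expiD addNr expi0. Qed.

Lemma polar z : exists2 t : R, 0 <= t <= 2 * pi & z = (rnorm z)%:C * expi t.
Proof.
have [->|z0] := eqVneq z 0.
  by exists 0; rewrite ?lexx ?ltW ?pi2_gt0// rnorm0 mul0r.
have n0 : 0 < rnorm z.
  rewrite lt_neqAle rnorm_ge0 andbT eq_sym; apply: contraNneq z0 => h.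
  by rewrite -normr_eq0 rnormE h.
set x := complex.Re z / rnorm z; set y := complex.Im z / rnorm z.
have xy : x ^+ 2 + y ^+ 2 = 1.
  by rewrite /x /y !expr_div_n -mulrDl -rnorm_sqr divff// expf_neq0// gt_eqF.
have x1 : -1 <= x <= 1.
  by rewrite -ler_norml -(@ler_pXn2r _ 2)// ?nnegrE// expr1n real_normK ?num_real//;
    rewrite -xy lerDl sqr_ge0.
have zE : z = (rnorm z)%:C * (x +i* y).
  rewrite /x /y; case: (z) n0 => a b /= n0; rewrite /GRing.mul /= !mul0r subr0 addr0.
  by rewrite !(mulrC (rnorm _)) !divfK ?gt_eqF.
have sE : sin (acos x) = `|y|.
  rewrite sin_acos//; have -> : 1 - x ^+ 2 = y ^+ 2 by rewrite -xy addrC addKr.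
  by rewrite sqrtr_sqr.
have [y0|y0] := leP 0 y.
  exists (acos x).
    by rewrite acos_ge0//= (le_trans (acos_lepi x1))// ler_peMl ?pi_ge0// ler1n.
  by rewrite {1}zE /expi acosK ?sE ?ger0_norm// in_itv.
(* [acos] only reaches the angles [0, pi] of the upper half-plane; the lower one is obtained by
   reflection. *)
exists (2 * pi - acos x).
  rewrite subr_ge0 gerBl acos_ge0// andbT (le_trans (acos_lepi x1))//.
  by rewrite ler_peMl ?pi_ge0// ler1n.
rewrite {1}zE /expi mulr_natl addrC cosD2pi sinD2pi cosN sinN acosK ?in_itv// sE.
by rewrite ltr0_norm// opprK.
Qed.

Lemma compact_closed_disc r : compact [set z : R[i]^o | rnorm z <= r].
Proof.
pose f (p : R * R) : R[i]^o := p.1 +i* p.2.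
have cf : continuous f.
  move=> p A /= /nbhs_rnormP[e e0 eA]; rewrite /nbhs /=.
  exists (ball p.1 (e / 2), ball p.2 (e / 2)) => /=.
    by split; apply: nbhsx_ballx; rewrite divr_gt0.
  move=> [x y] [/= h1 h2]; apply: eA; apply: (le_lt_trans (rnorm_le_ReIm _)) => /=.
  move: h1 h2; rewrite /ball /= => h1 h2.
  by rewrite distrC [X in _ + X]distrC; lra.
have cK : compact (f @` (`[- r, r] `*` `[- r, r])).
  apply: continuous_compact; first exact: continuous_subspaceT.
  by apply: compact_setX; exact: segment_compact.
apply: subclosed_compact cK _.
  apply: (closed_comp (f := @rnorm R R[i]^o) (D := [set x : R | x <= r])).
    by move=> z _; exact: rnorm_continuous.
  exact: closed_le.
move=> z /= zr; exists (complex.Re z, complex.Im z); last by case: (z).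
split => /=; rewrite in_itv /= -ler_norml.
  exact: le_trans (abs_Re_le z) zr.
exact: le_trans (abs_Im_le z) zr.
Qed.

Lemma rnorm_entry n (v : Cn R n) i j : rnorm (v i j) <= rnorm v.
Proof.
rewrite -lecR -!rnormE [leRHS]/Num.Def.normr /= mx_normE.
have -> : `|v i j| = (`|v i j|%:nng)%:num :> R[i] by [].
by rewrite num_le; apply: (le_bigmax _ (fun k => `|v k.1 k.2|%:nng) (i, j)).
Qed.

Lemma compact_closure_bounded n (A : set (Cn R n)) :
  bounded_set A -> compact (closure A).
Proof.
move=> [M [Mreal hM]].
(* The bound [M] lives in R[i]; it is real, hence smaller than [complex.Re M + 1]. *)
have Ar : A `<=` [set v | rnorm v <= complex.Re M + 1].
  move=> v Av /=; rewrite -lecR -rnormE; apply: hM => //.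
  rewrite ltcE /= ltrDl ltr01 andbT.
  by move: Mreal; rewrite realE !lecE /= => /orP[/andP[/eqP -> _]|/andP[/eqP <- _]].
have cl : closed [set v : Cn R n | rnorm v <= complex.Re M + 1].
  apply: (closed_comp (f := @rnorm R (Cn R n)) (D := [set x : R | x <= complex.Re M + 1])).
    by move=> z _; exact: rnorm_continuous.
  exact: closed_le.
apply: subclosed_compact (@closed_closure _ A)
  (@rV_compact _ n (fun=> [set z : R[i]^o | rnorm z <= complex.Re M + 1]) _) _.
  by move=> _; exact: compact_closed_disc.
move=> v /(closureS Ar); rewrite -(closure_id _).1// => /= vM i.
by rewrite (le_trans (rnorm_entry _ _ _)).
Qed.

End ComplexPlane.

(** * Upper semicontinuity and bounded real-valued psh functions *)

Section UpperSemicontinuous.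
Variable R : realType.

Definition usc_at (T : topologicalType) (F : T -> R) z :=
  forall a, F z < a -> \forall y \near z, F y < a.

Lemma usc_at_comp (T U : topologicalType) (f : T -> U) (F : U -> R) z :
  {for z, continuous f} -> usc_at F (f z) -> usc_at (F \o f) z.
Proof. by move=> cf uF a /uF; exact: cf. Qed.

Lemma usc_at_continuous (T : topologicalType) (F : T -> R) z :
  {for z, continuous F} -> usc_at F z.
Proof. by move=> cF a Fa; exact: (cvgr_lt _ cF). Qed.

Lemma usc_measurable (g : R -> R) : (forall t, usc_at g t) -> measurable_fun setT g.
Proof.
move=> ug; suff : measurable_fun setT (EFin \o (\- g)).
  move=> /measurable_EFinP /measurable_funN.
  by rewrite (_ : \- (\- g) = g)//; apply/funext => x /=; rewrite opprK.
apply: lower_semicontinuous_measurable => t a /=.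
rewrite lte_fin ltrNr => /ug h; exists [set y | g y < - a] => //.
by move=> y /=; rewrite lte_fin ltrNr.
Qed.

End UpperSemicontinuous.

Section Circles.
Variables (R : realType) (V : normedModType R[i]).
Implicit Types (a b z y : V) (F : V -> R) (D : set V).

Lemma expi_continuous : continuous (fun t : R => expi t : R[i]^o).
Proof.
move=> t A /= /nbhs_rnormP[e e0 eA].
have cc := @continuous_cos R t; have cs := @continuous_sin R t.
have h1 : \forall s \near t, `|cos t - cos s| < e / 2.
  by move/cvgrPdist_lt : cc; apply; rewrite divr_gt0.
have h2 : \forall s \near t, `|sin t - sin s| < e / 2.
  by move/cvgrPdist_lt : cs; apply; rewrite divr_gt0.
suff : \forall s \near t, A (expi s) by [].
near=> s; apply: eA; apply: (le_lt_trans (rnorm_le_ReIm _)) => /=.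
rewrite distrC [X in _ + X]distrC.
have : `|cos t - cos s| < e / 2 by near: s.
have : `|sin t - sin s| < e / 2 by near: s.
lra.
Unshelve. all: by end_near. Qed.

Lemma circle_continuous a b : continuous (fun t : R => a + (expi t : R[i]^o) *: b).
Proof.
move=> t; apply: cvgD; first exact: cvg_cst.
by apply: cvgZr_tmp; exact: expi_continuous.
Qed.

Lemma line_continuous a b : continuous (fun w : R[i]^o => a + w *: b).
Proof.
move=> w A /= /nbhs_rnormP[e e0 eA].
suff : \forall y \near w, A (a + y *: b) by [].
apply/nbhs_rnormP.
have b1 : 0 < rnorm b + 1 by rewrite ltr_wpDl// rnorm_ge0.
exists (e / (rnorm b + 1)); first by rewrite divr_gt0.
move=> y yw; apply: eA.
rewrite addrAC opprD addrA subrr add0r addrC -scalerBl rnormZ.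
rewrite ltr_pdivlMr// in yw; apply: le_lt_trans yw.
by rewrite ler_wpM2l ?rnorm_ge0// lerDl.
Qed.

Lemma disc_circle D a b : (forall w : R[i]^o, rnorm w <= 1 -> D (a + w *: b)) ->
  forall t, D (a + (expi t : R[i]^o) *: b).
Proof. by move=> h t; apply: h; rewrite rnorm_expi. Qed.

(** The bounds hold on all of [V], so that a sup-convolution may range over the whole space. Discs
    need no explicit radius, since [b] absorbs scale and rotation. *)
Record bounded_psh D F : Prop := BoundedPsh {
  bpsh_bound : forall z, -1 <= F z <= 0 ;
  bpsh_usc : forall z, D z -> usc_at F z ;
  bpsh_mean : forall a b, (forall w : R[i]^o, rnorm w <= 1 -> D (a + w *: b)) ->
    F a <= cmean (fun t => F (a + (expi t : R[i]^o) *: b)) }.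

Lemma bpsh_circle_measurable D F a b : bounded_psh D F ->
  (forall t, D (a + (expi t : R[i]^o) *: b)) ->
  bounded_measurable 0 (2 * pi) (fun t => F (a + (expi t : R[i]^o) *: b)).
Proof.
move=> [F01 uF _] Dab; split.
  apply: measurable_funS (@usc_measurable R _ _) => //.
  move=> t; apply: (@usc_at_comp R _ _ (fun t => a + (expi t : R[i]^o) *: b) F).
    exact: circle_continuous.
  exact: uF.
by exists 1 => t _; rewrite ler_norml; have /andP[h1 h2] := F01 (a + (expi t : R[i]^o) *: b);
  rewrite h1 (le_trans h2).
Qed.

Lemma le_bpsh_mean D F a b (phi : R -> R) : bounded_psh D F ->
  (forall w : R[i]^o, rnorm w <= 1 -> D (a + w *: b)) ->
  bounded_measurable 0 (2 * pi) phi ->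
  (forall t, 0 <= t <= 2 * pi -> F (a + (expi t : R[i]^o) *: b) <= phi t) ->
  F a <= cmean phi.
Proof.
move=> psF Dab bphi Fphi; rewrite (le_trans (bpsh_mean psF Dab))//.
by apply: le_cmean => //; apply: bpsh_circle_measurable psF _; exact: disc_circle.
Qed.

Lemma dilation_continuous (l : R[i]^o) : continuous (fun z : V => l *: z).
Proof. by move=> z; apply: cvgZl_tmp; exact: cvg_id. Qed.

Lemma bounded_psh_dilation D F (l : R[i]^o) : bounded_psh D F ->
  bounded_psh [set z | D (l *: z)] (fun z => F (l *: z)).
Proof.
move=> [h1 h2 h3]; split => //.
  move=> z /= Dz; apply: (@usc_at_comp R _ _ (fun z => l *: z)); last exact: h2.
  exact: dilation_continuous.
move=> a b /= Dab; have E w : l *: (a + w *: b) = l *: a + w *: (l *: b).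
  by rewrite scalerDr !scalerA mulrC.
under [X in cmean X]eq_fun do rewrite E.
by apply: h3 => w /Dab; rewrite E.
Qed.

End Circles.

(** * Sup-convolution as a Lipschitz regularisation *)

Section SupConvolution.
Variables (R : realType) (V : normedModType R[i]).
Implicit Types (y z : V) (k : R).

Definition sup_convolution k (F : V -> R) z : R :=
  sup [set F y - k * rnorm (y - z) | y in setT].

Variables (F : V -> R) (k : R).
Hypotheses (F01 : forall z, -1 <= F z <= 0) (k0 : 0 <= k).
Local Notation sc := (sup_convolution k F).

Lemma sup_convolution_le z (M : R) :
  (forall y, F y - k * rnorm (y - z) <= M) -> sc z <= M.
Proof.
move=> h; apply: ge_sup; first by exists (F z - k * rnorm (z - z)); exists z.
by move=> _ [y _ <-].
Qed.

Lemma sup_convolution_ge z y : F y - k * rnorm (y - z) <= sc z.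
Proof.
apply: ub_le_sup; last by exists y.
exists 0 => _ [x _ <-]; have /andP[_ Fx] := F01 x.
by rewrite subr_le0 (le_trans Fx)// mulr_ge0// rnorm_ge0.
Qed.

Lemma le_sup_convolution z : F z <= sc z.
Proof. by have := sup_convolution_ge z z; rewrite subrr rnorm0 mulr0 subr0. Qed.

Lemma sup_convolution_bound z : -1 <= sc z <= 0.
Proof.
apply/andP; split; first by have /andP[h _] := F01 z; rewrite (le_trans h)// le_sup_convolution.
apply: sup_convolution_le => y; have /andP[_ Fx] := F01 y.
by rewrite subr_le0 (le_trans Fx)// mulr_ge0// rnorm_ge0.
Qed.

Lemma sup_convolution_lipschitz z y : sc z <= sc y + k * rnorm (z - y).
Proof.
apply: sup_convolution_le => x; have := sup_convolution_ge y x.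
have := ler_wpM2l k0 (rdist_triangle z x y); rewrite mulrDr; lra.
Qed.

(** Since [F <= 0], a point at distance more than [d] contributes at most [- (k * d)], so that for
    large [k] only the values of [F] near [z] count. This yields both the bound on [A] and the
    convergence as [k] grows. *)
Lemma sup_convolution_local z (d beta : R) : - (k * d) <= beta ->
  (forall y, rnorm (y - z) <= d -> F y <= beta) -> sc z <= beta.
Proof.
move=> kd h; apply: sup_convolution_le => y.
have n0 := rnorm_ge0 (y - z).
have [yz|yz] := leP (rnorm (y - z)) d.
  by have := mulr_ge0 k0 n0; have := h _ yz; lra.
by have /andP[_ Fy] := F01 y; have := ler_wpM2l k0 (ltW yz); lra.
Qed.

Lemma sup_convolution_continuous : continuous sc.
Proof.
move=> z A /= /nbhs_ballP[e /= e0 eA]; apply/nbhs_rnormP.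
have k1 : 0 < k + 1 by rewrite ltr_wpDl.
exists (e / (k + 1)); first by rewrite divr_gt0.
move=> y yz; apply: eA; rewrite /ball /= distrC.
have h1 := sup_convolution_lipschitz y z; have h2 := sup_convolution_lipschitz z y.
have n0 := rnorm_ge0 (y - z).
have h3 : (k + 1) * rnorm (y - z) < e by rewrite mulrC -ltr_pdivlMr.
rewrite mulrDl mul1r in h3.
by rewrite ltr_norml; move: h2; rewrite rdistC => h2; lra.
Qed.

(* Translations by a vector longer than 1/k contribute at most -1 to the supremum, so only those
   that stay in D matter. *)
Lemma sup_convolution_psh (D D' : set V) : bounded_psh D F -> 0 < k ->
  (forall z y, D' z -> rnorm (y - z) <= k^-1 -> D y) -> bounded_psh D' sc.
Proof.
move=> psF kpos DD'; split; first exact: sup_convolution_bound.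
  by move=> z _; apply: usc_at_continuous; exact: sup_convolution_continuous.
move=> a b Dab.
have bsc : bounded_measurable 0 (2 * pi) (fun t => sc (a + (expi t : R[i]^o) *: b)).
  apply: bounded_measurable_continuous => t.
  by apply: continuous_comp; [exact: circle_continuous|exact: sup_convolution_continuous].
apply: sup_convolution_le => y; have [ya|ya] := leP (rnorm (y - a)) k^-1; last first.
  apply: (@le_trans _ _ (-1)).
    have /andP[_ Fy] := F01 y; have := ltW ya.
    by rewrite -(ler_pM2l kpos) divff ?gt_eqF//; lra.
  rewrite -[leLHS]cmean_cst; apply: le_cmean => //; first exact: bounded_measurable_cst.
  by move=> t _; have /andP[] := sup_convolution_bound (a + (expi t : R[i]^o) *: b).
rewrite lerBlDr -[X in _ + X]cmean_cst -cmeanD//; last exact: bounded_measurable_cst.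
apply: (le_bpsh_mean (b := b) psF).
- move=> w w1; apply: DD' (Dab w w1) _.
  by rewrite opprD addrACA subrr addr0.
- by apply: bounded_measurableD => //; exact: bounded_measurable_cst.
(* Centre and circle are translated by the same vector y - a, so that the penalty is the constant k
   |y - a|. *)
- move=> t _; have := sup_convolution_ge (a + (expi t : R[i]^o) *: b) (y + (expi t : R[i]^o) *: b).
  by rewrite opprD addrACA subrr addr0; lra.
Qed.

End SupConvolution.

(** * Passage between extended-valued and real-valued functions *)

Section Truncation.
Variables (R : realType) (n : nat).
Implicit Types (D : set (Cn R n)) (u : Cn R n -> \bar R) (F : Cn R n -> R).

Lemma EFin_cmean (f : R -> R) : bounded_measurable 0 (2 * pi) f ->
  (cmean f)%:E = (((2 * pi)^-1)%:E *
    \int[lebesgue_measure]_(t in `[0%R, (2 * pi)%R]) (f t)%:E)%E.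
Proof.
move=> bf; rewrite /cmean /Rintegral EFinM fineK//.
exact/integrable_fin_num/bounded_measurable_integrable.
Qed.

(** The value -1 off [D] is the floor of the truncation and gives the global bounds of
    [bounded_psh]. On [D], [fine] loses nothing once [u <= 0] there, the maximum being finite. *)
Definition truncation u D z : R :=
  if `[< D z >] then fine (maxe (u z) (-1)%:E) else -1.

Lemma truncationE D u z : psh_neg D u -> D z ->
  (truncation u D z)%:E = maxe (u z) (-1)%:E.
Proof.
move=> [_ u0] Dz; rewrite /truncation asboolT//.
by move: (u0 _ Dz); case: (u z) => [r| |] //= _; rewrite ?maxNye// -EFin_max.
Qed.

Lemma le_truncation D u z : psh_neg D u -> D z -> (u z <= (truncation u D z)%:E)%E.
Proof. by move=> pu Dz; rewrite truncationE// le_max lexx. Qed.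

Lemma truncation_lt D u z (a : R) : psh_neg D u -> D z -> -1 < a ->
  (truncation u D z < a) = (u z < a%:E)%E.
Proof.
by move=> pu Dz a1; rewrite -lte_fin truncationE// gt_max lte_fin a1 andbT.
Qed.

Lemma truncation_bound D u z : psh_neg D u -> -1 <= truncation u D z <= 0.
Proof.
move=> pu; have [Dz|nDz] := pselect (D z); last first.
  by rewrite /truncation asboolF// lexx lerN10.
rewrite -!lee_fin truncationE// le_max lexx orbT /= ge_max lee_fin lerN10 andbT.
by case: pu => _; exact.
Qed.

Lemma truncation_bpsh D u : open D -> psh_neg D u -> bounded_psh D (truncation u D).
Proof.
move=> oD pu; have F01 z := truncation_bound z pu.
have uF z : D z -> usc_at (truncation u D) z.
  move=> Dz a Fa; have a1 : -1 < a by have /andP[h _] := F01 z; exact: le_lt_trans Fa.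
  have nD : \forall y \near z, D y by exact: open_nbhs_nbhs.
  have : \forall w \near within D (nbhs z), (u w < a%:E)%E.
    by have := pu => -[[_ uu _] _]; apply: uu => //; rewrite -(truncation_lt pu).
  rewrite near_withinE => nu; near=> y.
  have Dy : D y by near: y.
  by rewrite (truncation_lt pu)//; move: Dy; near: y.
split => // a b Dab.
have bF : bounded_measurable 0 (2 * pi)
    (fun t => truncation u D (a + (expi t : R[i]^o) *: b)).
  split.
    apply: measurable_funS (@usc_measurable R _ _) => // t.
    apply: (@usc_at_comp R _ _ (fun t => a + (expi t : R[i]^o) *: b) (truncation u D)).
      exact: circle_continuous.
    by apply: uF; exact: disc_circle.
  exists 1 => t _; rewrite ler_norml.
  by have /andP[h1 h2] := F01 (a + (expi t : R[i]^o) *: b); rewrite h1 (le_trans h2).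
have Da : D a by have := Dab 0; rewrite rnorm0 scale0r addr0; exact.
have m1 : -1 <= cmean (fun t => truncation u D (a + (expi t : R[i]^o) *: b)).
  rewrite -[leLHS]cmean_cst; apply: le_cmean => //; first exact: bounded_measurable_cst.
  by move=> t _; have /andP[] := F01 (a + (expi t : R[i]^o) *: b).
rewrite -lee_fin truncationE// ge_max lee_fin m1 andbT EFin_cmean//.
have [[_ uu hu] u0] := pu.
have [_ _ /(_ 0 1 ltr01)] := hu a b.
rewrite scale0r addr0 => hm.
apply: (le_trans (hm _)) => [w|]; first by rewrite subr0 rnormE lecR; exact: Dab.
apply: lee_wpmul2l; first by rewrite lee_fin invr_ge0 ltW// pi2_gt0.
under eq_integral do rewrite add0r mul1r.
set g := fun t => u (a + (expi t : R[i]^o) *: b).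
set f := fun t => (truncation u D (a + (expi t : R[i]^o) *: b))%:E.
have Dt := disc_circle Dab.
(* [u] may take the value -oo on the circle. After a change of sign both integrands are nonnegative,
   and monotonicity of the integral holds for measurable functions, be the integrals finite or
   not. *)
have intN (h : R -> \bar R) : (forall t, h t <= 0)%E ->
    (\int[lebesgue_measure]_(t in `[0%R, (2 * pi)%R]) h t =
     - \int[lebesgue_measure]_(t in `[0%R, (2 * pi)%R]) (- h t))%E.
  move=> h0; rewrite -integral_ge0N => [|t _]; last by rewrite oppe_ge0.
  by apply: eq_integral => t _; rewrite oppeK.
have g0 t : (g t <= 0)%E by exact: u0.
have f0 t : (f t <= 0)%E.
  by rewrite lee_fin; have /andP[] := F01 (a + (expi t : R[i]^o) *: b).
rewrite (intN g)// (intN f)// leeN2; apply: ge0_le_integral => //.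
- by move=> t _; rewrite oppe_ge0.
- by apply/measurable_EFinP/measurable_funN; case: bF.
- apply: measurable_funS (@lower_semicontinuous_measurable R (fun t => - g t)%E _) => //.
  move=> t x xg; exists [set s | (g s < (- x)%:E)%E]; last first.
    by move=> s; rewrite /= EFinN lteNr.
  have gx : (g t < (- x)%:E)%E by rewrite EFinN lteNr.
  have h1 := uu _ (Dt t) _ gx; rewrite near_withinE in h1.
  have h2 : \forall s \near t, D (a + (expi s : R[i]^o) *: b) -> (g s < (- x)%:E)%E.
    exact: circle_continuous h1.
  by apply: filterS h2 => s; apply; exact: Dt.
- by move=> t _; rewrite leeN2; exact: le_truncation.
Unshelve. all: by end_near. Qed.

(** The way back from real-valued functions to [psh_neg], for the competitors of [omega_c]. A disc
    of radius r in a slice becomes a unit disc once [b] is replaced by r b. *)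
Lemma continuous_psh_neg D F : continuous F -> (forall z, F z <= 0) ->
  (forall a b, (forall w : R[i]^o, rnorm w <= 1 -> D (a + w *: b)) ->
    F a <= cmean (fun t => F (a + (expi t : R[i]^o) *: b))) ->
  psh_neg D (fun z => (F z)%:E).
Proof.
move=> cF F0 mF; split; last by move=> z _; rewrite lee_fin.
split; first by move=> z _; rewrite ltry.
  move=> z Dz a; rewrite lte_fin => Fa; rewrite near_withinE.
  have := usc_at_continuous (cF z) Fa; apply: filterS => y h _.
  by rewrite lte_fin.
move=> a b; split.
- by move=> w _; rewrite ltry.
- move=> w Dw x; rewrite lte_fin => Fx; rewrite near_withinE.
  have : usc_at (F \o (fun w : R[i]^o => a + w *: b)) w.
    apply: usc_at_comp; last by apply: usc_at_continuous; exact: cF.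
    exact: line_continuous.
  move=> /(_ x Fx) h; have {}h : \forall y \near w, F (a + y *: b) < x by exact: h.
  by apply: filterS h => y h _; rewrite lte_fin.
move=> c r r0 Dr.
have E w : a + (c + r%:C * w) *: b = (a + c *: b) + w *: (r%:C *: b).
  by rewrite scalerDl addrA scalerA mulrC.
under eq_integral do rewrite E.
rewrite -EFin_cmean; first rewrite lee_fin.
  apply: mF => w w1; rewrite -E; apply: Dr.
  by rewrite addrAC subrr add0r rnormE lecR rnormM rnorm_real gtr0_norm// ler_piMr// ltW.
apply: bounded_measurable_continuous => t.
by apply: continuous_comp; [exact: circle_continuous|exact: cF].
Qed.

End Truncation.

(** * A maximum principle in the plane *)

Section MaximumPrinciple.
Variable R : realType.
Local Notation C := (R[i]^o).
Implicit Types (f G : C -> R) (c w z : C) (r : R).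

(** Phrased through majorants [phi], so that the maximum principle involves no measurability of [f]
    on circles. *)
Definition submean f c r := forall phi : R -> R,
  bounded_measurable 0 (2 * pi) phi ->
  (forall t, 0 <= t <= 2 * pi -> f (c + r%:C * expi t) <= phi t) -> f c <= cmean phi.

(* Re (p w) and Re (q w^2) have mean 0 on circles |w| = r, so that the mean of G around c is
   G c + O(r^3); this replaces the mean value property in the maximum principle. *)
Definition harmonic2 G c := exists (p q : C) (M r0 : R),
  [/\ 0 <= M, 0 < r0 & forall w, rnorm w < r0 ->
    `|G (c + w) - (G c + complex.Re (p * w) + complex.Re (q * w ^+ 2))| <= M * rnorm w ^+ 3].

Lemma harmonic2_cst (x : R) c : harmonic2 (fun=> x) c.
Proof.
exists 0, 0, 0, 1; split => // w _.
by rewrite !mul0r /= !addr0 subrr normr0.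
Qed.

Lemma harmonic2D G1 G2 c : harmonic2 G1 c -> harmonic2 G2 c ->
  harmonic2 (fun z => G1 z + G2 z) c.
Proof.
move=> [p [q [M [r [M0 r0 h]]]]] [p' [q' [M' [r' [M0' r0' h']]]]].
exists (p + p'), (q + q'), (M + M'), (Num.min r r'); split.
- exact: addr_ge0.
- by rewrite lt_min r0.
move=> w; rewrite lt_min => /andP[wr wr'].
have := h w wr; have := h' w wr'; set x := M' * _; set y := M * _.
rewrite !mulrDl !cReD -/x -/y !ler_norml => /andP[h1 h2] /andP[h3 h4].
by apply/andP; split; lra.
Qed.

Lemma harmonic2Z (k : R) G c : harmonic2 G c -> harmonic2 (fun z => k * G z) c.
Proof.
move=> [p [q [M [r [M0 r0 h]]]]].
exists (k%:C * p), (k%:C * q), (`|k| * M), r; split => //; first exact: mulr_ge0.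
move=> w wr.
have Rek (x y : C) : complex.Re (k%:C * x * y) = k * complex.Re (x * y).
  by case: x => a b; case: y => d e /=; ring.
by rewrite !Rek -!mulrDr -mulrBr normrM -mulrA ler_wpM2l// h.
Qed.

Lemma harmonic2_sum n (g : 'I_n -> C -> R) c : (forall i, harmonic2 (g i) c) ->
  harmonic2 (fun z => \sum_(i < n) g i z) c.
Proof.
move=> hg; elim: (index_enum _) => [|i s IH].
  rewrite (_ : (fun z => _) = fun=> 0); first exact: harmonic2_cst.
  by apply/funext => z; rewrite big_nil.
rewrite (_ : (fun z => _) = fun z => g i z + \sum_(j <- s) g j z).
  exact: harmonic2D.
by apply/funext => z; rewrite big_cons.
Qed.

Lemma harmonic2_continuous G c : harmonic2 G c -> {for c, continuous G}.
Proof.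
move=> [p [q [M [r [M0 r0 h]]]]].
have K0 : 0 < rnorm p + rnorm q + M + 1.
  by rewrite ltr_wpDl// !addr_ge0// rnorm_ge0.
set K := _ + 1 in K0.
move=> A /= /nbhs_ballP[e /= e0 eA].
suff : \forall z \near c, A (G z) by [].
apply/nbhs_rnormP; exists (Num.min (Num.min r 1) (e / K)).
  by rewrite !lt_min r0 ltr01 divr_gt0.
move=> y; rewrite !lt_min => /andP[/andP[yr y1] ye]; apply: eA; rewrite /ball /=.
have := h _ yr; rewrite addrCA subrr addr0; set w := y - c in yr y1 ye *.
have w0 := rnorm_ge0 w.
have hp : `|complex.Re (p * w)| <= rnorm p * rnorm w by rewrite -rnormM abs_Re_le.
have w2 : rnorm w ^+ 2 <= rnorm w by rewrite expr2 ler_piMl// ltW.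
have w3 : rnorm w ^+ 3 <= rnorm w by rewrite exprS (le_trans _ w2)// expr2 ler_wpM2l.
have hq : `|complex.Re (q * w ^+ 2)| <= rnorm q * rnorm w.
  apply: (le_trans (abs_Re_le _)); rewrite rnormM ler_wpM2l ?rnorm_ge0//.
  by rewrite expr2 rnormM -expr2.
have hM : M * rnorm w ^+ 3 <= M * rnorm w by rewrite ler_wpM2l.
have hK : K * rnorm w < e by rewrite mulrC -ltr_pdivlMr.
have KE : K * rnorm w = rnorm p * rnorm w + rnorm q * rnorm w + M * rnorm w + rnorm w.
  by rewrite /K; ring.
move=> hh; rewrite -normrN opprB; move: hh hp hq.
rewrite !ler_norml => /andP[h1 h2] /andP[h3 h4] /andP[h5 h6].
by rewrite ltr_norml; apply/andP; split; lra.
Qed.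

Lemma usc_atD (T : topologicalType) (f h : T -> R) (z : T) : usc_at f z ->
  {for z, continuous h} -> usc_at (fun y => f y + h y) z.
Proof.
move=> uf ch a fa; pose e := (a - (f z + h z)) / 2.
have e0 : 0 < e by rewrite divr_gt0// subr_gt0.
have h1 : \forall y \near z, f y < f z + e by apply: uf; rewrite ltrDl.
have h2 : \forall y \near z, h y < h z + e by apply: (usc_at_continuous ch); rewrite ltrDl.
near=> y.
have : f y < f z + e by near: y.
have : h y < h z + e by near: y.
by rewrite /e; lra.
Unshelve. all: by end_near. Qed.

(** The points where [f c <= G c] is granted play the part of the boundary of [K]. At any other
    point, a maximum of f - G + k |z|^2 is impossible: on a circle of radius r the mean of |z|^2
    exceeds its value at the centre by r^2. *)
Lemma maximum_principle (K : set C) (M : R) f G : compact K ->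
  (forall c, K c -> rnorm c <= M) -> (forall c, K c -> usc_at f c) ->
  (forall c, K c -> harmonic2 G c) ->
  (forall c, K c -> f c <= G c \/
     exists2 r0 : R, 0 < r0 & forall r, 0 < r < r0 ->
       submean f c r /\ forall t : R, K (c + r%:C * expi t)) ->
  forall c, K c -> f c <= G c.
Proof.
move=> cK KM uf hG good c0 Kc0; rewrite leNgt; apply/negP => fG.
pose e := f c0 - G c0; have e0 : 0 < e by rewrite subr_gt0.
have M0 : 0 <= M by exact: le_trans (rnorm_ge0 _) (KM _ Kc0).
have M2 : 0 < M ^+ 2 + 1 by rewrite ltr_wpDl// sqr_ge0.
(* The perturbation k |z|^2 beats the error O(r^3) at a maximum point. *)
pose k := e / (2 * (M ^+ 2 + 1)).
have k0 : 0 < k by rewrite divr_gt0// mulr_gt0.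
(* Hence k |z|^2 <= e / 2 on [K], whereas [W c0] is at least e: the maximum of [W] is not at a point
   where f <= G. *)
have kE : k * (M ^+ 2 + 1) = e / 2 by rewrite /k; field; rewrite gt_eqF.
pose W z := f z + (- G z + k * rnorm z ^+ 2).
have uW z : K z -> usc_at W z.
  move=> Kz; apply: usc_atD; first exact: uf.
  apply: continuousD; first by apply: continuousN; apply: harmonic2_continuous; exact: hG.
  apply: (@continuousM _ _ (fun=> k) (fun z => rnorm z ^+ 2)).
    by move=> A; exact: cst_continuous.
  by apply: continuousM; exact: rnorm_continuous.
have [|c Kc Wc] := usc_compact_max cK (ex_intro _ c0 Kc0) (W := W).
  by move=> z Kz a Wa; have := uW z Kz a Wa; apply: filterS.
have Wc0 : e <= W c.
  rewrite (le_trans _ (Wc _ Kc0))// /W addrA lerDl mulr_ge0// ?(ltW k0)//.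
  by rewrite exprn_ge0// rnorm_ge0.
have [fc|[r0 r00 hr]] := good c Kc.
  have : rnorm c ^+ 2 <= M ^+ 2 by rewrite ler_pXn2r// ?nnegrE ?rnorm_ge0// KM.
  move=> /(ler_wpM2l (ltW k0)); move: Wc0 kE; rewrite /W mulrDr mulr1; lra.
have [p [q [C0 [r1 [C00 r10 hC]]]]] := hG c Kc.
pose r := Num.min (Num.min r0 r1) (k / (C0 + 1)) / 2.
have m0 : 0 < Num.min (Num.min r0 r1) (k / (C0 + 1)).
  by rewrite !lt_min r00 r10 divr_gt0// ltr_wpDl.
have rpos : 0 < r by rewrite divr_gt0.
have : r < Num.min (Num.min r0 r1) (k / (C0 + 1)) by rewrite /r ltr_pdivrMr// ltr_pMr// ltr1n.
rewrite !lt_min => /andP[/andP[rr0 rr1] rk].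
have [|sm Kr] := hr r; first by rewrite rpos.
have {}rk : C0 * r < k.
  rewrite ltr_pdivlMr ?ltr_wpDl// in rk.
  by apply: le_lt_trans rk; rewrite mulrDr mulr1 mulrC lerDl ltW.
(* Maximality gives f (c + w) <= W c + G (c + w) - k |c + w|^2. Expanding the right-hand side at w =
   r e^{it} gives [phi], with mean [A] = f c + C0 r^3 - k r^2, which is less than f c. *)
pose A := W c + G c + C0 * r ^+ 3 - k * rnorm c ^+ 2 - k * r ^+ 2.
pose phi := trig2 A (r * complex.Re p - 2 * k * r * complex.Re c)
  (r * complex.Im p + 2 * k * r * complex.Im c)
  (r ^+ 2 * complex.Re q) (r ^+ 2 * complex.Im q).
have : f c <= cmean phi.
  apply: sm; first exact/bounded_measurable_continuous/trig2_continuous.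
  move=> t _; set w := r%:C * expi t.
  have nw : rnorm (w : C) = r by rewrite rnormM rnorm_real rnorm_expi mulr1 gtr0_norm.
  have h1 := Wc _ (Kr t).
  have /(_ _)/ler_normlP[|_ h2] := hC w; first by rewrite nw.
  have nc : rnorm (c + w : C) ^+ 2 = rnorm c ^+ 2 + r ^+ 2 +
      2 * r * (complex.Re c * cos t + complex.Im c * sin t).
    rewrite !rnorm_sqr.
    have -> : r ^+ 2 = r ^+ 2 * (cos t ^+ 2 + sin t ^+ 2) by rewrite cos2Dsin2 mulr1.
    by rewrite /w; case: (c) => x y /=; ring.
  have E1 : complex.Re (p * w) = r * complex.Re p * cos t - r * complex.Im p * sin t.
    by rewrite /w; case: (p) => x y /=; ring.
  have E2 : complex.Re (q * w ^+ 2) = r ^+ 2 * complex.Re q * (cos t ^+ 2 - sin t ^+ 2)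
     - r ^+ 2 * complex.Im q * (2 * (cos t * sin t)).
    by rewrite /w; case: (q) => x y /=; ring.
  rewrite /phi /trig2 /A; move: h1 h2; rewrite {1}/W nc nw E1 E2.
  nra.
rewrite cmean_trig2 /A /W.
have : C0 * r ^+ 3 < k * r ^+ 2 by rewrite exprS mulrA ltr_pM2r// exprn_gt0.
lra.
Qed.

End MaximumPrinciple.

(** * Harnack's inequality for Lipschitz functions on the disc *)

Section HarnackBound.
Variable R : realType.
Local Notation C := (R[i]^o).
Implicit Types (f : C -> R) (c w z : C) (r : R).

Lemma rnormV z : rnorm (z^-1 : C) = (rnorm z)^-1.
Proof.
have nE (x : C) : rnorm x = Normc.normc x by rewrite rnorm_complexE; case: x.
by rewrite !nE Normc.normcV.
Qed.

Lemma Re_div z w : complex.Re (z / w : C) =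
  (complex.Re z * complex.Re w + complex.Im z * complex.Im w) / rnorm w ^+ 2.
Proof.
have ReV : complex.Re (w^-1) = complex.Re w / rnorm w ^+ 2.
  by rewrite rnorm_sqr; case: (w).
have ImV : complex.Im (w^-1) = - complex.Im w / rnorm w ^+ 2.
  by rewrite rnorm_sqr; case: (w) => a b /=; rewrite mulNr.
by rewrite cReM ReV ImV; ring.
Qed.

Lemma rnormX z k : rnorm (z ^+ k : C) = rnorm z ^+ k.
Proof.
elim: k => [|k IH]; last by rewrite !exprS rnormM IH.
by rewrite !expr0 rnorm_complexE /= expr1n expr0n addr0 sqrtr1.
Qed.

(** Geometric expansion of 1 / (d - w) with d = a - c: the exact remainder w^3 / (d^3 (d - w)) is
    controlled by |d - w| >= |d| / 2. *)
Lemma harmonic2_cauchy (e a : C) c : a != c ->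
  harmonic2 (fun z => complex.Re (e / (a - z) : C)) c.
Proof.
move=> ac; pose d := a - c; have d0 : d != 0 by rewrite subr_eq0.
have nd : 0 < rnorm (d : C).
  by rewrite -ltcR -rnormE normr_gt0.
exists (e / d ^+ 2), (e / d ^+ 3), (rnorm (e : C) / rnorm (d : C) ^+ 3 * (2 / rnorm (d : C))),
  (rnorm (d : C) / 2); split.
- by rewrite !mulr_ge0// ?rnorm_ge0 ?invr_ge0 ?exprn_ge0 ?rnorm_ge0.
- by rewrite divr_gt0.
move=> w wd.
have dw : rnorm (d : C) / 2 <= rnorm (d - w : C).
  by have := rnormD (d - w : C) w; rewrite subrK; lra.
have dw0 : d - w != 0.
  apply: contraTneq dw => ->; rewrite rnorm0 -ltNge divr_gt0//.
have -> : e / (a - (c + w)) = e / d + e / d ^+ 2 * w + e / d ^+ 3 * w ^+ 2 +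
    e / d ^+ 3 / (d - w) * w ^+ 3.
  have -> : a - (c + w) = d - w by rewrite /d opprD addrA.
  by field; rewrite d0 dw0.
rewrite !cReD -/d addrAC subrr add0r (le_trans (abs_Re_le _))//.
have -> : rnorm (e / d ^+ 3 / (d - w) * w ^+ 3 : C) =
    rnorm (e : C) / rnorm (d : C) ^+ 3 * (rnorm (d - w : C))^-1 * rnorm w ^+ 3.
  by rewrite 3!rnormM !rnormV !rnormX.
rewrite ler_wpM2r ?exprn_ge0 ?rnorm_ge0// ler_wpM2l//.
  by rewrite mulr_ge0 ?rnorm_ge0// invr_ge0 exprn_ge0// rnorm_ge0.
rewrite -[2 / _]invrK invf_div lef_pV2// posrE ?divr_gt0//.
by apply: lt_le_trans dw; rewrite divr_gt0.
Qed.

(** The factor 2, instead of the sharp 1, comes from the mean value theorem applied to [cos] and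
    [sin] separately. *)
Lemma circle_lipschitz (s t : R) : rnorm (expi s - expi t : C) <= 2 * `|s - t|.
Proof.
wlog st : s t / s <= t.
  move=> H; case: (leP s t) => [|/ltW] /H //.
  by rewrite rdistC distrC.
apply: (le_trans (rnorm_le_ReIm _)) => /=; rewrite mulr_natl mulr2n; apply: lerD.
  have [|c _ h] := @MVT_segment R cos (fun x => - sin x) s t st.
    by apply: continuous_subspaceT; exact: continuous_cos.
  by rewrite distrC h normrM normrN [in leRHS]distrC ler_piMl ?sin_max.
have [|c _ h] := @MVT_segment R sin cos s t st.
  by apply: continuous_subspaceT; exact: continuous_sin.
by rewrite distrC h normrM [in leRHS]distrC ler_piMl ?cos_max.
Qed.

Lemma subdivision (T t : R) N : 0 <= t -> t <= T *+ N.+1 ->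
  exists2 k, (k <= N)%N & T *+ k <= t <= T *+ k.+1.
Proof.
move=> t0; elim: N => [|N IH] tN; first by exists 0%N; rewrite // mulr0n t0.
have [/IH[k kN kP]|h] := leP t (T *+ N.+1); first by exists k => //; exact: leqW.
by exists N.+1; rewrite // ltW.
Qed.

(* The Poisson integral is replaced by a sum of Cauchy kernels with poles at distance 1/N from
   the unit circle, weighted by sample values of f at N points of the circle. *)
Lemma harnack_bound f (L : R) : 0 <= L -> (forall z, 0 <= f z) ->
  (forall z w, f z <= f w + L * rnorm (z - w)) ->
  (forall c r, 0 < r -> rnorm c + r <= 1 -> submean f c r) ->
  forall c, rnorm c < 1 -> f c <= 289 / (1 - rnorm c) * cmean (fun t => f (expi t)).
Proof.
move=> L0 f0 fL fsub c c1; have c289 : 0 < 289 :> R by rewrite ltr0n.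
have cf : continuous f.
  move=> z A /= /nbhs_ballP[e /= e0 eA].
  suff : \forall y \near z, A (f y) by [].
  apply/nbhs_rnormP; have k1 : 0 < L + 1 by rewrite ltr_wpDl.
  exists (e / (L + 1)); first by rewrite divr_gt0.
  move=> y yz; apply: eA; rewrite /ball /= distrC.
  have h1 := fL y z; have h2 := fL z y; have n0 := rnorm_ge0 (y - z).
  have h3 : (L + 1) * rnorm (y - z) < e by rewrite mulrC -ltr_pdivlMr.
  rewrite mulrDl mul1r in h3.
  by rewrite ltr_norml; move: h2; rewrite rdistC => h2; lra.
have bf : bounded_measurable 0 (2 * pi) (fun t => f (expi t)).
  apply: bounded_measurable_continuous => t.
  apply: (@continuous_comp _ _ _ (fun t : R => expi t : C) f); first exact: expi_continuous.
  exact: cf.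
set m := cmean _.
have d0 : 0 < 1 - rnorm c by rewrite subr_gt0.
set d := 1 - rnorm c in d0 *.
(* Two errors to be made small: [eta] from the choice of the sample points, 16 L / N.+1 from
   replacing a boundary value by a sample. *)
suff H eta N : 0 < eta -> f c <= 289 / d * (m + eta) + 16 * L / N.+1%:R.
  apply/ler_addgt0Pr => e e0.
  have e1 : 0 < e / 2 * d / 289 by rewrite !mulr_gt0 ?invr_gt0 ?c289.
  pose N := Num.Def.archi_bound (32 * L / e).
  have := H (e / 2 * d / 289) N e1; set K := 289 / d.
  have -> : K * (m + e / 2 * d / 289) = K * m + e / 2.
    by rewrite /K; field; rewrite gt_eqF.
  move=> h; apply: (le_trans h); rewrite -addrA lerD2l.
  have NL : 32 * L / e < N%:R.
    by apply: archi_boundP; rewrite divr_ge0// ?(ltW e0)// mulr_ge0.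
  have N1 : (N%:R : R) <= N.+1%:R by rewrite ler_nat.
  rewrite ltr_pdivrMr// in NL.
  have : 16 * L / N.+1%:R <= e / 2.
    rewrite ler_pdivrMr ?ltr0n// -[leRHS]mulrC.
    have : N%:R * e <= N.+1%:R * e by rewrite ler_pM2r.
    lra.
  by move: (16 * L / N.+1%:R) => q; lra.
move=> eta0.
have N0 : 0 < N.+1%:R :> R by rewrite ltr0n.
pose T : R := 2 * pi / N.+1%:R.
have T0 : 0 < T by rewrite divr_gt0// pi2_gt0.
have TN : T *+ N.+1 = 2 * pi by rewrite -[LHS]mulr_natr divfK// gt_eqF.
have bfT : bounded_measurable 0 (T *+ N.+1) (fun t => f (expi t)) by rewrite TN.
have [a [aP sa]] := @sample_points R T eta _ N.+1 T0 eta0 bfT.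
pose h : R := N.+1%:R^-1; have h0 : 0 < h by rewrite invr_gt0.
have hN : h * N.+1%:R = 1 by rewrite mulVf// gt_eqF.
have avg : h * \sum_(k < N.+1) f (expi (a k)) <= m + eta.
  move: sa; rewrite TN.
  have -> : T * eta *+ N.+1 = 2 * pi * eta by rewrite -mulrnAl TN.
  have -> : T = 2 * pi * h by [].
  have -> : \int[lebesgue_measure]_(t in `[0, 2 * pi]) f (expi t) = 2 * pi * m.
    by rewrite /m /cmean mulVKf// gt_eqF ?pi2_gt0.
  by rewrite -mulrA -[leRHS]mulrDr ler_pM2l ?pi2_gt0.
pose e k := expi (a k) : C.
pose w k : C := (1 + h)%:C * e k.
(* Cauchy kernels with poles [w k] at distance [h] outside the circle. Their real parts are
   nonnegative on the closed disc and of order 1 / h on the arc of the k-th sample, so that on this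
   arc the k-th term alone dominates a fixed fraction of [f (e k)]. *)
pose B z := h * \sum_(k < N.+1) f (e k) * complex.Re (e k / (w k - z) : C).
have wdist k z : rnorm z <= 1 -> h <= rnorm (w k - z : C).
  move=> z1; have := rnormD (w k - z : C) z; rewrite subrK rnormM rnorm_real rnorm_expi.
  by rewrite mulr1 ger0_norm; lra.
(* 289 is 17 ^ 2: a point of the circle is within 17 h of the pole of its arc, where the kernel is
   at least h / (17 h)^2. The other term pays for replacing [f z] by [f (e k)], at distance at most
   16 h. *)
pose G z := 289 * B z + 16 * L * h.
have GP z : rnorm z <= 1 -> harmonic2 G z.
  move=> z1; apply: harmonic2D; last exact: harmonic2_cst.
  apply: harmonic2Z; apply: harmonic2Z; apply: harmonic2_sum => k; apply: harmonic2Z.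
  apply: harmonic2_cauchy; apply: contraTneq (wdist k z z1) => ->.
  by rewrite subrr rnorm0 -ltNge.
have termE k z : complex.Re (e k / (w k - z) : C) =
    (1 + h - complex.Re (z * expi (- a k))) / rnorm (w k - z : C) ^+ 2.
  rewrite Re_div; congr (_ / _); rewrite /w /e /expi cosN sinN; case: z => z1 z2 /=.
  move: (cos _) (sin _) (cos2Dsin2 (a k)) => u v uv.
  transitivity ((1 + h) * (u ^+ 2 + v ^+ 2) - (z1 * u + z2 * v)); first by ring.
  by rewrite uv; ring.
have rot k z : complex.Re (z * expi (- a k)) <= rnorm z.
  apply: (le_trans (ler_norm _)); apply: (le_trans (abs_Re_le _)).
  by rewrite rnormM rnorm_expi mulr1.
have term_ge z k : rnorm z <= 1 -> h / rnorm (w k - z : C) ^+ 2 <= complex.Re (e k / (w k - z) : C).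
  move=> z1; rewrite termE ler_wpM2r ?invr_ge0 ?exprn_ge0 ?rnorm_ge0//.
  by have := rot k z; lra.
have term_ge0 z k : rnorm z <= 1 -> 0 <= complex.Re (e k / (w k - z) : C).
  move=> z1; apply: le_trans (term_ge z k z1).
  by rewrite divr_ge0 ?(ltW h0) ?exprn_ge0 ?rnorm_ge0.
have fG : f c <= G c.
  apply: (@maximum_principle R [set z | rnorm z <= 1] 1 f G) (ltW c1) => //.
  - exact: compact_closed_disc.
  - by move=> z _; apply: usc_at_continuous; exact: cf.
  move=> z /= z1; have [zlt|zge] := ltP (rnorm z) 1; [right|left].
    exists (1 - rnorm z); first by rewrite subr_gt0.
    move=> r /andP[r0 r1]; split; first by apply: fsub => //; lra.
    move=> t; rewrite (le_trans (rnormD _ _))// rnormM rnorm_real rnorm_expi mulr1.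
    by rewrite gtr0_norm//; lra.
  have [t /andP[t0 t2] zE] := polar z.
  have {}z1 : rnorm z = 1 by apply/eqP; rewrite eq_le z1.
  rewrite z1 mul1r in zE.
  have [k kN /andP[k1 k2]] : exists2 k, (k <= N)%N & T *+ k <= t <= T *+ k.+1.
    by apply: subdivision; rewrite // TN.
  have /andP[a1 a2] := aP k kN.
  have ta : `|t - a k| <= T by rewrite ler_norml !mulrS in k2 a2 *; lra.
  (* 2 pi < 8; [circle_lipschitz] turns 8 h into 16 h, and the distance [h] from the circle to the
     pole makes 17 h. *)
  have Th : T <= 8 * h by rewrite /T ler_wpM2r ?(ltW h0)//; have := pi_lt4 R; lra.
  have zek : rnorm (z - e k : C) <= 16 * h.
    by rewrite zE (le_trans (circle_lipschitz _ _))//; lra.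
  have wz : rnorm (w k - z : C) <= 17 * h.
    have -> : w k - z = (h%:C : C) * e k + (e k - z) :> C.
      by rewrite /w rmorphD mulrDl mul1r addrAC addrC.
    rewrite (le_trans (rnormD _ _))// rnormM rnorm_real rnorm_expi mulr1 rdistC.
    by rewrite gtr0_norm//; lra.
  have wz0 : 0 < rnorm (w k - z : C) by rewrite (lt_le_trans h0)// wdist// z1.
  have hk : 1 <= 289 * h * complex.Re (e k / (w k - z) : C).
    rewrite -ler_pdivrMl; last by rewrite mulr_gt0 ?c289.
    rewrite mulr1 (le_trans _ (term_ge z k _)) ?z1// ler_pdivlMr ?exprn_gt0//.
    rewrite ler_pdivrMl ?mulr_gt0 ?c289//.
    by nra.
  have fz := fL z (e k).
  have fk : f (e k) <= 289 * B z.
    have Bk : h * (f (e k) * complex.Re (e k / (w k - z) : C)) <= B z.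
      rewrite /B ler_wpM2l ?(ltW h0)// (bigD1 (Ordinal (n := N.+1) kN)) //= lerDl.
      by rewrite sumr_ge0// => i _; rewrite mulr_ge0// term_ge0 ?z1.
    have := ler_wpM2l (f0 (e k)) hk; rewrite mulr1; lra.
  rewrite /G; have := ler_wpM2l L0 zek; lra.
(* At the interior point [c] every kernel is at most 1 / |w k - c| <= 1 / d, so that [B c] is
   controlled by the average of the samples. *)
have Bc : B c <= (m + eta) / d.
  rewrite ler_pdivlMr// (le_trans _ avg)// /B -mulrA ler_wpM2l ?(ltW h0)// mulr_suml.
  apply: ler_sum => k _; rewrite -mulrA ler_piMr//.
  have wc : d <= rnorm (w k - c : C).
    have := rnormD (w k - c : C) c; rewrite subrK rnormM rnorm_real rnorm_expi.
    by rewrite mulr1 ger0_norm /d; lra.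
  have wc0 : 0 < rnorm (w k - c : C) by exact: lt_le_trans wc.
  rewrite (@le_trans _ _ ((rnorm (w k - c : C))^-1 * d))//.
    rewrite ler_wpM2r ?(ltW d0)// (le_trans (ler_norm _))// (le_trans (abs_Re_le _))//.
    by rewrite rnormM rnormV rnorm_expi mul1r.
  by rewrite mulrC ler_pdivrMr// mul1r.
apply: (le_trans fG); rewrite /G -/h lerD2r.
by rewrite -mulrA (mulrC d^-1) ler_pM2l ?c289.
Qed.

End HarnackBound.

(** * Non-thinness of a half-line at its endpoint *)

Section Slit.
Variable R : realType.
Local Notation C := (R[i]^o).
Implicit Types (f : C -> R) (c w z : C) (r : R).

(* Comparison with the harmonic polynomial G on the upper half of a disc centred on the
   slit improves the bound on a fixed fraction of each small circle around the origin. *)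
Lemma slit_bound f (R0 beta : R) : 0 < R0 ->
  (forall c, rnorm c < R0 -> usc_at f c) ->
  (forall c r, 0 < r -> rnorm c + r < R0 -> submean f c r) ->
  (forall r, 0 < r < R0 -> bounded_measurable 0 (2 * pi) (fun t => f (r%:C * expi t))) ->
  (forall t : R, 0 < t < R0 -> f t%:C <= beta) -> f 0 <= beta.
Proof.
move=> R00 uf sf bf fslit; rewrite leNgt; apply/negP => mb.
set m := f 0 in mb; pose e := m - beta; have e0 : 0 < e by rewrite subr_gt0.
(* Half of the gain e / 256 obtained at the end: at least e / 2 on at least 1/128 of the circle. *)
pose th := e / 512; have th0 : 0 < th by rewrite /th; lra.
have /nbhs_rnormP[R1 R10 fR1] : \forall z \near (0 : C), f z < m + th.
  by apply: uf; rewrite ?rnorm0// ltrDl.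
pose rho := Num.min R0 R1 / 4.
have m0 : 0 < Num.min R0 R1 by rewrite lt_min R00.
have rho0 : 0 < rho by rewrite divr_gt0.
have rhoR0 : 4 * rho <= R0 by rewrite /rho mulrC divfK// ge_min lexx.
have rhoR1 : 4 * rho <= R1 by rewrite /rho mulrC divfK// ge_min lexx orbT.
pose X : C := rho%:C.
(* On the slit [H] is a nonnegative square, so that G >= beta >= f. On the half circle of radius rho
   / 2 around [X] it is at least 1, so that G >= m + th >= f. It vanishes at [X], which makes it
   small on a short arc starting there. *)
pose H z : R := 4 / rho * complex.Im z + 4 / rho ^+ 2 * complex.Re ((z - X) ^+ 2 : C).
pose G z : R := beta + (m + th - beta) * H z.
pose K : set C := [set z | rnorm (z - X) <= rho / 2] `&` [set z | 0 <= complex.Im z].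
have KR z : K z -> rnorm z <= 3 / 2 * rho.
  move=> [/= zX _]; rewrite -(subrK X z) (le_trans (rnormD _ _))//.
  by rewrite rnorm_real gtr0_norm//; lra.
have cIm : continuous (fun z : C => complex.Im z).
  move=> z A /= /nbhs_ballP[d /= d0 dA].
  suff : \forall y \near z, A (complex.Im y) by [].
  apply/nbhs_rnormP; exists d => // y yz; apply: dA; rewrite /ball /= distrC.
  by apply: le_lt_trans yz; rewrite -[_ - _](_ : complex.Im (y - z) = _) ?abs_Im_le//;
    case: (y) (z) => a b [].
have cK : compact K.
  apply: subclosed_compact (compact_closed_disc (r := 3 / 2 * rho)) KR.
  apply: closedI.
    apply: (closed_comp (f := fun z => rnorm (z - X)) (D := [set x : R | x <= rho / 2])).
      by move=> z _; exact: rdist_continuous.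
    exact: closed_le.
  apply: (closed_comp (f := fun z : C => complex.Im z) (D := [set x : R | 0 <= x])).
    by move=> z _; exact: cIm.
  exact: closed_ge.
have hG c : harmonic2 G c.
  apply: harmonic2D; first exact: harmonic2_cst.
  apply: harmonic2Z; apply: harmonic2D; apply: harmonic2Z.
    exists (- 'i), 0, 0, 1; split => // w _.
    case: w c => a b [x y] /=; rewrite !mul0r le_eqVlt normr_eq0; apply/orP; left.
    by apply/eqP; ring.
  exists (2 * (c - X)), 1, 0, 1; split => // w _.
  case: w c => a b [x y] /=; rewrite !mul0r le_eqVlt normr_eq0; apply/orP; left.
  by apply/eqP; rewrite /X /=; ring.
have fG z : K z -> f z <= G z.
  apply: (maximum_principle cK KR) => [c Kc|c _|c Kc]; last 2 first.
  - exact: hG.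
  - have cR := KR _ Kc.
    have [cX c0] := Kc; rewrite /= in cX c0.
    have [ci|ci] := leP (complex.Im c) 0.
      left; have {}ci : complex.Im c = 0 by apply/eqP; rewrite eq_le ci.
      have cE : c = (complex.Re c)%:C by case: (c) ci => a b /= ->.
      have : `|complex.Re c - rho| <= rho / 2.
        by apply: le_trans cX; rewrite cE -rmorphB rnorm_real.
      rewrite ler_norml => /andP[h1 h2].
      rewrite {1}cE (le_trans (fslit _ _))//; first by apply/andP; split; lra.
      rewrite /G /H ci mulr0 add0r lerDl mulr_ge0//; first by rewrite /e in e0; lra.
      rewrite mulr_ge0//; first by rewrite divr_ge0// exprn_ge0// ltW.
      by rewrite cE -rmorphB -rmorphXn /= sqr_ge0.
    have [cb|cb] := leP (rho / 2) (rnorm (c - X)).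
      left; have {}cb : rnorm (c - X) = rho / 2 by apply/eqP; rewrite eq_le cX cb.
      have H1 : 1 <= H c.
        have xy : (complex.Re c - rho) ^+ 2 + complex.Im c ^+ 2 = (rho / 2) ^+ 2.
          by rewrite -cb rnorm_sqr; case: (c) => a b /=; rewrite subr0.
        have yr : complex.Im c <= rho / 2.
          rewrite -(ler_pXn2r (n := 2)) ?nnegrE//; last by lra.
          by rewrite -xy lerDr sqr_ge0.
        have -> : H c = 1 + 4 * complex.Im c * (rho - 2 * complex.Im c) / rho ^+ 2.
          have -> : H c = 4 / rho * complex.Im c + 4 / rho ^+ 2 *
              ((complex.Re c - rho) ^+ 2 - complex.Im c ^+ 2).
            by rewrite /H /X; case: (c) => a b /=; ring.
          have -> : (complex.Re c - rho) ^+ 2 = (rho / 2) ^+ 2 - complex.Im c ^+ 2.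
            by rewrite -xy addrK.
          by field; rewrite gt_eqF.
        rewrite lerDl divr_ge0 ?exprn_ge0 ?(ltW rho0)// mulr_ge0 ?mulr_ge0 ?(ltW ci)//.
        by lra.
      have fm : f c <= m + th by apply/ltW/fR1; rewrite subr0; lra.
      have : m + th - beta <= (m + th - beta) * H c.
        by rewrite ler_peMr// /e in e0 *; lra.
      rewrite /G; lra.
    right; exists (Num.min (rho / 2 - rnorm (c - X)) (complex.Im c)).
      by rewrite lt_min subr_gt0 cb.
    move=> r; rewrite lt_min => /andP[r0 /andP[r1 r2]]; split.
      by have := rnorm_ge0 (c - X) => h; apply: (sf c r) => //; lra.
    move=> t; split => /=.
      rewrite addrAC (le_trans (rnormD _ _))// rnormM rnorm_real rnorm_expi mulr1.
      by rewrite gtr0_norm//; lra.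
    have -> : complex.Im (c + r%:C * expi t) = complex.Im c + r * sin t.
      by case: (c) => a b /=; ring.
    by have := sin_geN1 t; have := ler_wpM2l (ltW r0) (sin_geN1 t); lra.
  by apply: uf; have := KR _ Kc; lra.
(* For 0 <= t <= 1/16 one has H <= 1/2, so that [f] is at most the midpoint of beta and m + th. *)
have arc : cmean (fun t => f (rho%:C * expi t)) <=
    m + th - (m + th - (m + th + beta) / 2) * ((1 / 16 - 0) / (2 * pi)).
  apply: cmean_arc => //.
  - by apply: bf; apply/andP; split; lra.
  - by have := pi_ge2 R; lra.
  - move=> t _; apply/ltW/fR1; rewrite subr0 rnormM rnorm_real rnorm_expi mulr1.
    by rewrite gtr0_norm//; lra.
  move=> t /andP[t0 t1].
  set y := sin t; set x := 1 - cos t.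
  have d2 : rnorm (expi t - 1 : C) <= 2 * t.
    by have := circle_lipschitz t (0 : R); rewrite expi0 subr0 ger0_norm.
  have xy : x ^+ 2 + y ^+ 2 = 2 * x.
    by have := cos2Dsin2 t; rewrite /x /y; move: (cos t) (sin t) => u v uv; rewrite sqrrB; lra.
  have x0 : 0 <= x by rewrite /x subr_ge0 cos_le1.
  have x1 : x <= 2 * t.
    rewrite (le_trans (ler_norm _))// (le_trans _ d2)// -normrN opprB.
    by rewrite (_ : cos t - 1 = complex.Re (expi t - 1 : C)) ?abs_Re_le.
  have y0 : 0 <= y by apply: sin_ge0_pi; rewrite t0; have := pi_ge2 R; lra.
  have y1 : y <= 2 * t.
    rewrite (le_trans (ler_norm _))// (le_trans _ d2)//.
    by rewrite (_ : y = complex.Im (expi t - 1 : C)) ?abs_Im_le//= subr0.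
  have XE : rho%:C * expi t - X = rho%:C * (expi t - 1) by rewrite mulrBr mulr1.
  have Kt : K (rho%:C * expi t).
    split => /=; last by rewrite mul0r addr0 mulr_ge0// ltW.
    rewrite XE rnormM rnorm_real gtr0_norm// ler_pM2l//; lra.
  rewrite (le_trans (fG _ Kt))// /G.
  have -> : H (rho%:C * expi t) = 4 * y + 4 * (x ^+ 2 - y ^+ 2).
    rewrite /H XE /x /y /expi /=; field.
    by rewrite gt_eqF.
  (* By [xy], x^2 - y^2 = 2 x (x - 1) <= 0, while y <= 2 t <= 1/8. *)
  have : 4 * y + 4 * (x ^+ 2 - y ^+ 2) <= 1 / 2 by nra.
  have : 0 < m + th - beta by rewrite /e in e0; lra.
  by nra.
have : f 0 <= cmean (fun t => f (rho%:C * expi t)).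
  apply: (sf 0 rho) => //; first by rewrite rnorm0; lra.
    by apply: bf; apply/andP; split; lra.
  by move=> t _; rewrite add0r.
rewrite -/m; have : 1 / 128 <= (1 / 16 - 0) / (2 * pi) :> R.
  by rewrite ler_pdivlMr ?pi2_gt0//; have := pi_lt4 R; lra.
set q := _ / (2 * pi) => hq mc.
have : m <= m + th - e / 2 * (1 / 128).
  rewrite (le_trans mc)// (le_trans arc)// lerD2l lerN2 ler_pM//; rewrite /e /th; lra.
rewrite /th; lra.
Qed.

End Slit.

(** * Harnack's inequality and boundary limits on discs in [D] *)

Section Slices.
Variables (R : realType) (V : normedModType R[i]) (D : set V) (F : V -> R).
Hypothesis psF : bounded_psh D F.
Local Notation C := (R[i]^o).
Implicit Types (a b z v : V) (c w l : C).

Let F01 z : -1 <= F z <= 0. Proof. exact: bpsh_bound psF z. Qed.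

Lemma slice_submean a b c (r : R) : 0 < r ->
  (forall w, rnorm (w - c) <= r -> D (a + w *: b)) ->
  submean (fun w : C => F (a + w *: b)) c r.
Proof.
move=> r0 Dab phi bphi hphi.
have E w : a + (c + r%:C * w) *: b = (a + c *: b) + w *: ((r%:C : C) *: b).
  by rewrite scalerDl addrA scalerA [in RHS]mulrC.
apply: (le_bpsh_mean (b := (r%:C : C) *: b) psF) => //.
  move=> w w1; rewrite -E; apply: Dab.
  by rewrite addrAC subrr add0r rnormM rnorm_real gtr0_norm// ler_piMr// ltW.
by move=> t tI; rewrite -E; exact: hphi.
Qed.

Lemma slice_usc a b c : D (a + c *: b) -> usc_at (fun w : C => F (a + w *: b)) c.
Proof.
move=> Dc; apply: (@usc_at_comp R _ _ (fun w : C => a + w *: b) F).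
  exact: line_continuous.
exact: (bpsh_usc psF).
Qed.

End Slices.

Lemma submean_addr (R : realType) (f : R[i]^o -> R) c (r k : R) :
  submean f c r -> submean (fun z => f z + k) c r.
Proof.
move=> sf phi bphi hphi.
have bk : bounded_measurable 0 (2 * pi) (fun=> - k : R) by exact: bounded_measurable_cst.
rewrite -lerBrDr -[X in _ + X]cmean_cst -cmeanD//.
apply: sf; first exact: bounded_measurableD.
by move=> t tI; have := hphi t tI; lra.
Qed.

Section Harnack.
Variables (R : realType) (V : normedModType R[i]) (D : set V) (F : V -> R).
Hypothesis psF : bounded_psh D F.
Local Notation C := (R[i]^o).
Implicit Types (a b z v : V) (c w l : C).

Let F01 z : -1 <= F z <= 0. Proof. exact: bpsh_bound psF z. Qed.

(** The offset [k0] serves [bpsh_harnack]: with penalties at least d^-1 from the start, all the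
    sup-convolutions are psh around the same disc. *)
Lemma sup_convolution_cvg z (k0 : R) : 0 <= k0 -> usc_at F z ->
  sup_convolution (n%:R + k0) F z @[n --> \oo] --> F z.
Proof.
move=> k00 uF; apply/cvgrPdist_le => e e0.
have /nbhs_rnormP[d d0 Fd] : \forall y \near z, F y < F z + e by apply: uF; rewrite ltrDl.
near=> n.
have n0 : 0 <= n%:R + k0 by rewrite addr_ge0.
have h1 := le_sup_convolution F01 n0 z.
have nd : 2 / d < n%:R.
  near: n; exists (Num.Def.archi_bound (2 / d)) => // n /= hn.
  by apply: (lt_le_trans (archi_boundP _)); rewrite ?ler_nat// divr_ge0// ltW.
have h2 : sup_convolution (n%:R + k0) F z <= F z + e.
  apply: (sup_convolution_local F01 n0 (d := d / 2)).
    have /andP[Fz _] := F01 z.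
    have : 2 <= n%:R * d by rewrite ltr_pdivrMr// in nd; exact: ltW.
    have := mulr_ge0 k00 (ltW d0); rewrite mulrDl; lra.
  move=> y yz; apply/ltW/Fd; lra.
by rewrite distrC ler_norml; apply/andP; split; lra.
Unshelve. all: by end_near. Qed.

Hypothesis oD : open D.

Lemma compact_disc_orbit a z : compact [set y | exists2 l : C, rnorm l <= 1 & y = a + l *: z].
Proof.
rewrite (_ : mkset _ = (fun l : C => a + l *: z) @` [set l | rnorm l <= 1]).
  apply: continuous_compact; last exact: compact_closed_disc.
  by apply: continuous_subspaceT; exact: line_continuous.
by apply/seteqP; split => [y [l l1 ->]|y [l l1 <-]]; exists l.
Qed.

(** [harnack_bound] applies to the sup-convolutions, which are Lipschitz and lie above [F]; on the
    circle they converge pointwise to [F] within fixed bounds, so that their means converge too. *)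
Lemma bpsh_harnack z c : (forall l, rnorm l <= 1 -> D (l *: z)) -> rnorm c < 1 ->
  F (c *: z) + 1 <= 289 / (1 - rnorm c) * cmean (fun t => F ((expi t : C) *: z) + 1).
Proof.
move=> Dz c1.
have [d d0 Kd] : exists2 d : R, 0 < d & forall l y, rnorm l <= 1 -> rnorm (y - l *: z) <= d -> D y.
  have [|d d0 h] := @compact_thicken R V _ D (@compact_disc_orbit 0 z).
    by move=> y [l l1 ->]; rewrite add0r; apply: open_nbhs_nbhs; split => //; exact: Dz.
  exists d => // l y l1; apply: h; exists l => //; by rewrite add0r.
have k0 : 0 < d^-1 by rewrite invr_gt0.
pose g n (t : R) := sup_convolution (n%:R + d^-1) F ((expi t : C) *: z) + 1.
have kn n : 0 < n%:R + d^-1 by rewrite ltr_wpDl.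
have gb n : bounded_measurable 0 (2 * pi) (g n).
  apply: bounded_measurableD; last exact: bounded_measurable_cst.
  apply: bounded_measurable_continuous => t.
  apply: (@continuous_comp _ _ _ (fun t => (expi t : C) *: z) (sup_convolution (n%:R + d^-1) F)).
    have := @circle_continuous R V 0 z t.
    by rewrite (_ : (fun t => 0 + _) = fun t => (expi t : C) *: z)//;
      apply/funext => s; rewrite add0r.
  by apply: sup_convolution_continuous => //; exact: ltW.
have Fb : bounded_measurable 0 (2 * pi) (fun t => F ((expi t : C) *: z) + 1).
  apply: bounded_measurableD; last exact: bounded_measurable_cst.
  have := bpsh_circle_measurable (a := 0) (b := z) psF.
  under eq_fun do rewrite add0r; apply => t.
  by rewrite add0r; apply: Dz; rewrite rnorm_expi.
have gF : cmean (g n) @[n --> \oo] --> cmean (fun t => F ((expi t : C) *: z) + 1).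
  apply: (@cmean_cvg R g _ 1 gb Fb).
    move=> n t _; have /andP[h1 h2] := sup_convolution_bound F01 (ltW (kn n)) ((expi t : C) *: z).
    by rewrite ler_norml /g; apply/andP; split; lra.
  move=> t _; apply: cvgD; last exact: cvg_cst.
  apply: sup_convolution_cvg; first exact: ltW.
  by apply: (bpsh_usc psF); apply: Dz; rewrite rnorm_expi.
have gle n : F (c *: z) + 1 <= 289 / (1 - rnorm c) * cmean (g n).
  have kn0 := ltW (kn n).
  pose f (w : C) := sup_convolution (n%:R + d^-1) F (w *: z) + 1.
  have psS : bounded_psh [set y | exists2 l : C, rnorm l <= 1 & y = 0 + l *: z]
      (sup_convolution (n%:R + d^-1) F).
    apply: (sup_convolution_psh F01 kn0 psF (kn n)) => x y [l l1 ->]; rewrite add0r => yl.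
    apply: (Kd l) => //; rewrite (le_trans yl)// -[leRHS]invrK lef_pV2// ?posrE//.
    by rewrite lerDr.
  apply: (@le_trans _ _ (f c)); first by rewrite lerD2r le_sup_convolution.
  apply: (@harnack_bound R f ((n%:R + d^-1) * rnorm z)) => //.
  - by rewrite mulr_ge0// rnorm_ge0.
  - by move=> w; have /andP[h _] := sup_convolution_bound F01 kn0 (w *: z); rewrite /f; lra.
  - move=> w w'; have := sup_convolution_lipschitz F01 kn0 (w *: z) (w' *: z).
    by rewrite -scalerBl rnormZ /f; lra.
  move=> w r r0 wr; apply: submean_addr.
  have -> : (fun x : C => sup_convolution (n%:R + d^-1) F (x *: z)) =
      fun x => sup_convolution (n%:R + d^-1) F (0 + x *: z).
    by apply/funext => x; rewrite add0r.
  apply: (slice_submean psS r0) => x xw; exists x => //.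
  by rewrite -(subrK w x) (le_trans (rnormD _ _))//; lra.
have cK : 289 / (1 - rnorm c) * cmean (g n) @[n --> \oo] -->
    289 / (1 - rnorm c) * cmean (fun t => F ((expi t : C) *: z) + 1).
  exact: cvgMl_tmp.
by apply: (cvgr_to_ge cK); exact: nearW.
Qed.

(** [d] may depend on [theta], so that the convergence is only pointwise on the circle: this is why
    a mean is used here, and Harnack's inequality to descend from the mean to interior points. *)
Lemma bpsh_boundary_limit (zeta v : V) (e : R) (s : C) :
  (forall z l, D z -> rnorm l <= 1 -> D (l *: z)) -> 0 < e ->
  (forall t : R, 0 < t < e -> D (zeta + (t%:C : C) *: v)) ->
  (forall theta eta : R, 0 < eta -> exists2 d : R, 0 < d &
    forall t : R, 0 < t < d -> F ((expi theta : C) *: (zeta + (t%:C : C) *: v)) <= -1 + eta) ->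
  rnorm s < 1 -> D (s *: zeta) -> F (s *: zeta) <= -1.
Proof.
move=> discD e0 Dt lim s1 Ds.
apply/ler_addgt0Pr => eta eta0.
pose I t := cmean (fun theta => F ((expi theta : C) *: (zeta + (t%:C : C) *: v)) + 1).
have Fb t : 0 < t < e ->
    bounded_measurable 0 (2 * pi) (fun th => F ((expi th : C) *: (zeta + (t%:C : C) *: v)) + 1).
  move=> te; apply: bounded_measurableD; last exact: bounded_measurable_cst.
  have := bpsh_circle_measurable (a := 0) (b := zeta + (t%:C : C) *: v) psF.
  under eq_fun do rewrite add0r; apply => th.
  by rewrite add0r; apply: discD; [exact: Dt|rewrite rnorm_expi].
pose K := 289 / (1 - rnorm s).
have K0 : 0 < K by rewrite divr_gt0 ?subr_gt0 ?ltr0n.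
(* Dominated convergence runs along sequences: if no [d] works, there are t n <= 1 / (n + 1) with
   means at least eta / K, [K] being the Harnack constant at [s]. *)
have [d [d0 de hd]] : exists d : R, [/\ 0 < d, d <= e & forall t, 0 < t < d -> I t < eta / K].
  apply: contrapT => nd.
  have h n : exists t : R, [/\ 0 < t < e, t <= n.+1%:R^-1 & eta / K <= I t].
    apply: contrapT => nt; apply: nd; exists (Num.min e n.+1%:R^-1); split.
    - by rewrite lt_min e0 invr_gt0 ltr0n.
    - by rewrite ge_min lexx.
    move=> t /andP[t0]; rewrite lt_min => /andP[te tn]; rewrite ltNge; apply/negP => It.
    by apply: nt; exists t; rewrite t0 te ltW.
  have [t ht] := choice h.
  have tb n : 0 < t n < e by case: (ht n).
  have : cmean (fun theta => F ((expi theta : C) *: (zeta + ((t n)%:C : C) *: v)) + 1)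
      @[n --> \oo] --> cmean (fun=> 0 : R).
    apply: (@cmean_cvg R _ _ 1) => //; first by move=> n; apply: Fb.
    - exact: bounded_measurable_cst.
    - move=> n th _; have /andP[h1 h2] := F01 ((expi th : C) *: (zeta + ((t n)%:C : C) *: v)).
      by rewrite ler_norml; apply/andP; split; lra.
    move=> th _; apply/cvgrPdist_le => x x0.
    have [d d0 hd] := lim th x x0.
    near=> n.
    have /andP[h1 _] := F01 ((expi th : C) *: (zeta + ((t n)%:C : C) *: v)).
    have h2 : F ((expi th : C) *: (zeta + ((t n)%:C : C) *: v)) <= -1 + x.
      apply: hd; have /andP[-> _] /= := tb n; have [_ tn _] := ht n.
      apply: (le_lt_trans tn); near: n; exact: near_infty_natSinv_lt (PosNum d0).
    by rewrite sub0r normrN ler_norml; apply/andP; split; lra.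
  move=> h0; have : eta / K <= cmean (fun=> 0 : R).
    by apply: (cvgr_to_ge h0); apply: nearW => n; case: (ht n).
  by rewrite cmean_cst leNgt divr_gt0.
have Ft t : 0 < t < d -> F (s *: (zeta + (t%:C : C) *: v)) <= -1 + eta.
  move=> /andP[t0 td]; have te : 0 < t < e by rewrite t0 (lt_le_trans td).
  have := @bpsh_harnack (zeta + (t%:C : C) *: v) s (fun l => discD _ l (Dt t te)) s1.
  have := hd t; rewrite t0 td => /(_ isT); rewrite ltr_pdivlMr// mulrC -/K /I; lra.
(* The bound for t > 0 is carried over to t = 0 on the slice w |-> s zeta + w s v, whose slit is the
   positive real axis. *)
have /nbhs_rnormP[d1 d10 Dd1] : \forall w \near (0 : C), D (s *: zeta + w *: (s *: v)).
  apply: line_continuous; rewrite scale0r addr0; exact: open_nbhs_nbhs.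
pose R0 := Num.min d d1.
have h0 : F (s *: zeta) = F (s *: zeta + (0 : C) *: (s *: v)) by rewrite scale0r addr0.
rewrite h0; apply: (@slit_bound R (fun w => F (s *: zeta + w *: (s *: v))) R0).
- by rewrite lt_min d0.
- move=> c; rewrite lt_min => /andP[_ cd]; apply: (@slice_usc _ _ _ _ psF (s *: zeta) (s *: v) c).
  by apply: Dd1; rewrite subr0.
- move=> c r r0; rewrite lt_min => /andP[_ cd].
  apply: (@slice_submean _ _ _ _ psF (s *: zeta) (s *: v) c r r0) => w wc.
  by apply: Dd1; rewrite subr0 -(subrK c w) (le_lt_trans (rnormD _ _))//; lra.
- move=> r; rewrite lt_min => /andP[r0 /andP[_ rd]].
  have := bpsh_circle_measurable (a := s *: zeta) (b := (r%:C : C) *: (s *: v)) psF.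
  have E th : s *: zeta + (expi th : C) *: ((r%:C : C) *: (s *: v)) =
      s *: zeta + (r%:C * expi th : C) *: (s *: v) by rewrite [in LHS]scalerA mulrC.
  under eq_fun do rewrite E; apply => th.
  by rewrite E; apply: Dd1; rewrite subr0 rnormM rnorm_real rnorm_expi mulr1 gtr0_norm.
move=> t; rewrite lt_min => /andP[t0 /andP[td _]].
have -> : s *: zeta + (t%:C : C) *: (s *: v) = s *: (zeta + (t%:C : C) *: v).
  by rewrite scalerDr !scalerA mulrC.
by apply: Ft; rewrite t0.
Unshelve. all: by end_near. Qed.

End Harnack.

(** * From the open disc to its boundary point *)

Section BoundedPshRadial.
Variables (R : realType) (V : normedModType R[i]) (D : set V) (F : V -> R).
Hypothesis psF : bounded_psh D F.
Local Notation C := (R[i]^o).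

(* A fixed part of a small circle centred at a maximum point over the closed unit disc lies inside
   the disc. *)
Lemma bpsh_radial_le (z : V) (M : R) : open D ->
  (forall l : C, rnorm l <= 1 -> D (l *: z)) ->
  (forall l : C, rnorm l < 1 -> F (l *: z) <= M) -> F z <= M.
Proof.
move=> oD Dz FM; rewrite leNgt; apply/negP => Mz.
pose f (l : C) := F (0 + l *: z).
have fE l : f l = F (l *: z) by rewrite /f add0r.
have [||c /= c1 fc] := @usc_compact_max R C _ f (@compact_closed_disc R 1).
    by exists 0; rewrite /= rnorm0.
  move=> l /= l1 a fa; have : usc_at f l.
    by apply: (@slice_usc _ _ _ _ psF 0 z l); rewrite add0r; exact: Dz.
  by move=> /(_ a fa); apply: filterS.
have Mc : M < f c.
  apply: (lt_le_trans Mz); have := fc 1; rewrite fE scale1r; apply => /=.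
  by rewrite rnorm_real normr1.
pose e := f c - M; have e0 : 0 < e by rewrite subr_gt0.
have [d d0 hd] : exists2 d : R, 0 < d &
    forall l w : C, rnorm l <= 1 -> rnorm (w - l) <= d -> D (w *: z) /\ f w < f c + e / 128.
  have [|d d0 h] := @compact_thicken R C _ [set w | D (w *: z) /\ f w < f c + e / 128]
      (@compact_closed_disc R 1).
    move=> l /= l1; have h1 : \forall w \near l, f w < f c + e / 128.
      have : usc_at f l.
        by apply: (@slice_usc _ _ _ _ psF 0 z l); rewrite add0r; exact: Dz.
      by apply; rewrite (le_lt_trans (fc l l1))// ltrDl; lra.
    have h2 : \forall w \near l, D (0 + w *: z).
      by apply: line_continuous; rewrite add0r; apply: open_nbhs_nbhs; split => //; exact: Dz.
    by apply: filterS2 h1 h2 => w h1 h2; split => //; rewrite -[w *: z]add0r.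
  by exists d => // l w l1; exact: h l1.
have c1E : rnorm c = 1.
  apply/eqP; rewrite eq_le c1 leNgt /=; apply/negP => c2.
  by have := FM c c2; rewrite -fE leNgt Mc.
(* The circle is c (1 + r e^{it}), pointing to the origin at t = pi. *)
pose r := Num.min d (1 / 2); have r0 : 0 < r by rewrite lt_min d0; lra.
have rd : r <= d by rewrite ge_min lexx.
have r1 : r <= 1 / 2 by rewrite ge_min lexx orbT.
have EE w : c *: z + w *: ((r%:C * c : C) *: z) = (c + (r%:C * w : C) * c) *: z.
  rewrite scalerA scalerDl; congr (_ + _ *: _).
  by rewrite mulrA [X in X * _ = _]mulrC.
have dist (w : C) : rnorm w <= 1 -> rnorm (c + (r%:C * w : C) * c - c : C) <= d.
  move=> w1; rewrite addrAC subrr add0r !rnormM c1E mulr1 rnorm_real gtr0_norm//.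
  by rewrite (le_trans _ rd)// ler_piMr// ltW.
have Dd (w : C) : rnorm w <= 1 -> D (c *: z + w *: ((r%:C * c : C) *: z)).
  by move=> /dist w1; rewrite EE; have [] := hd c _ c1 w1.
have := bpsh_mean psF Dd.
have bm : bounded_measurable 0 (2 * pi)
    (fun t => F (c *: z + (expi t : C) *: ((r%:C * c : C) *: z))).
  by apply: bpsh_circle_measurable psF _; exact: disc_circle.
have p2 := pi_ge2 R; have p4 := pi_lt4 R.
(* On [pi - 1/8, pi], cos t <= -3/4, so that |1 + r e^{it}|^2 <= 1 - 3 r / 2 + r^2 < 1 as r <= 1/2,
   and [M] bounds [f] there. The arc is at least 1/64 of the circle: the gain is at least e / 64,
   twice the slack e / 128. *)
have := @cmean_arc R _ (f c + e / 128) M (pi - 1 / 8) pi bm.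
have -> : pi - (pi - 1 / 8) = 1 / 8 :> R by rewrite opprB addrC subrK.
set mF := cmean _ => arc mc.
have {arc} arc : mF <= f c + e / 128 - (f c + e / 128 - M) * (1 / 8 / (2 * pi)).
  apply: arc.
  - by lra.
  - by lra.
  - by lra.
  - move=> t _; rewrite EE -fE.
    have [|_ /ltW//] := hd c (c + (r%:C * expi t : C) * c) c1.
    by apply: dist; rewrite rnorm_expi.
  move=> t /andP[t0 t1]; rewrite EE; apply: FM.
  have -> : c + (r%:C * expi t : C) * c = (1 + r%:C * expi t : C) * c :> C.
    by rewrite mulrDl mul1r.
  rewrite rnormM c1E mulr1 -(@ltr_pXn2r _ 2)// ?nnegrE ?rnorm_ge0// expr1n rnorm_sqr /=.
  have ct : cos t <= - (3 / 4).
    have -> : t = - (pi - t) + pi by rewrite opprB subrK.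
    rewrite cosDpi cosN lerN2.
    have := circle_lipschitz (pi - t) 0; rewrite expi0 subr0 ger0_norm ?subr_ge0//.
    move=> /(le_trans (abs_Re_le _)) /=; rewrite ler_norml => /andP[h _].
    lra.
  rewrite !mul0r subr0 !addr0 add0r.
  have -> : (1 + r * cos t) ^+ 2 + (r * sin t) ^+ 2 = 1 + 2 * r * cos t + r ^+ 2.
    have -> : r ^+ 2 = r ^+ 2 * (cos t ^+ 2 + sin t ^+ 2) by rewrite cos2Dsin2 mulr1.
    by ring.
  nra.
have : 1 / 64 <= 1 / 8 / (2 * pi) :> R by rewrite ler_pdivlMr ?pi2_gt0//; lra.
rewrite -fE in mc; set q := 1 / 8 / _ in arc * => hq.
have : (f c + e / 128 - M) * (1 / 64) <= (f c + e / 128 - M) * q.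
  by rewrite ler_wpM2l//; rewrite /e in e0 *; lra.
rewrite /e in e0 arc *; lra.
Qed.

End BoundedPshRadial.

Section LimsupFilter.
Variables (R : realType).
Local Open Scope ereal_scope.

Lemma limf_esup_le (T : choiceType) (X : filteredType T) (f : X -> \bar R)
    (G : set_system X) (a e : R) : (0 < e)%R -> limf_esup f G <= a%:E ->
  exists2 W, G W & forall x, W x -> f x <= (a + e)%:E.
Proof.
move=> e0; rewrite limf_esupE => h.
have : ereal_inf [set ereal_sup (f @` V) | V in G] < (a + e)%:E.
  by rewrite (le_lt_trans h)// lte_fin ltrDl.
move=> /ereal_inf_lt[_ [W GW <-]] /ltW Wa; exists W => // x Wx.
by apply: le_trans Wa; apply: ereal_sup_ubound; exists x.
Qed.

Lemma le_limf_esup (T : choiceType) (X : filteredType T) (f : X -> \bar R)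
    (G : set_system X) (a : R) :
  (forall e : R, (0 < e)%R -> G [set x | f x <= (a + e)%:E]) -> limf_esup f G <= a%:E.
Proof.
move=> h; apply/lee_addgt0Pr => e e0; rewrite limf_esupE -EFinD.
apply: (@le_trans _ _ (ereal_sup (f @` [set x | f x <= (a + e)%:E]))).
  by apply: ereal_inf_lbound; exists [set x | f x <= (a + e)%:E] => //; exact: h.
by apply: ge_ereal_sup => _ [x /= xa <-].
Qed.

Lemma limsup_inP n (B : set (Cn R n)) (u : Cn R n -> \bar R) x (a : R) :
  limsup_in B u x <= a%:E <->
  forall e : R, (0 < e)%R -> exists2 d : R, (0 < d)%R &
    forall y, B y -> (rnorm (y - x) < d)%R -> u y <= (a + e)%:E.
Proof.
split=> [h e e0|h].
  have [W BW Wu] := limf_esup_le e0 h.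
  have /nbhs_rnormP[d d0 hd] : \forall y \near x, B y -> W y by exact: BW.
  by exists d => // y By yx; apply: Wu; exact: hd.
apply: le_limf_esup => e e0; have [d d0 hd] := h e e0.
suff : \forall y \near x, B y -> u y <= (a + e)%:E by [].
by apply/nbhs_rnormP; exists d => // y yx By; exact: hd.
Qed.

End LimsupFilter.

(** * Competitors for [omega_c] in circular star-shaped domains *)

Section StarShapedDomains.
Variables (R : realType) (n : nat) (D : set (Cn R n)).
Hypotheses (domD : domain D) (circD : circular D) (starD : strongly_star_shaped D).
Local Notation C := (R[i]^o).

Lemma star_shaped_open_disc (z : Cn R n) (l : C) : closure D z -> rnorm l < 1 -> D (l *: z).
Proof.
move=> Dz l1; have [t _ ->] := polar l.
have [l0|l0] := ltP 0 (rnorm l).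
  by rewrite mulrC -scalerA; apply: circD; apply: starD => //; rewrite l0.
have -> : rnorm l = 0 by apply/eqP; rewrite eq_le l0 rnorm_ge0.
rewrite mul0r scale0r.
(* [strongly_star_shaped] only speaks of r > 0. Small multiples of a point of [D] put 0 in the
   closure, and dilation by 1/2 then puts it in [D]. *)
have cl0 : closure D 0.
  case: domD => _ _ [x Dx] B /nbhs_rnormP[e e0 eB].
  have x0 := rnorm_ge0 x; have k0 : 0 < rnorm x + 1 by rewrite ltr_wpDl.
  pose r := Num.min (1 / 2) (e / (rnorm x + 1) / 2).
  have r0 : 0 < r by rewrite lt_min !divr_gt0.
  exists ((r%:C : C) *: x); split.
    apply: starD; last exact: subset_closure.
    by rewrite r0 /= (@le_lt_trans _ _ (1 / 2)) ?ge_min ?lexx//; lra.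
  apply: eB; rewrite subr0 rnormZ rnorm_real gtr0_norm//.
  have : r <= e / (rnorm x + 1) / 2 by rewrite ge_min lexx orbT.
  rewrite ler_pdivlMr// ler_pdivlMr//; nra.
have := starD (r := 1 / 2) _ cl0; rewrite scaler0; apply; apply/andP; split; lra.
Qed.

Lemma star_shaped_disc (z : Cn R n) (l : C) : D z -> rnorm l <= 1 -> D (l *: z).
Proof.
move=> Dz; rewrite le_eqVlt => /orP[/eqP l1|]; last first.
  by apply: star_shaped_open_disc; exact: subset_closure.
by have [t _ ->] := polar l; rewrite l1 mul1r; exact: circD.
Qed.

Hypothesis bndD : bounded_set D.
Variables (A : set (Cn R n)) (u : Cn R n -> \bar R).
Hypotheses (subA : A `<=` closure D) (compA : compact A) (pu : psh_neg D u).

Let oD : open D. Proof. by case: domD. Qed.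

Lemma dilation_le_omega_c z (l : C) : D z -> rnorm l < 1 ->
  (forall x (s : C), A x -> rnorm s < 1 -> truncation u D (s *: x) <= -1) ->
  ((truncation u D (l *: z))%:E <= omega_c A D z)%E.
Proof.
move=> Dz l1 coneA.
pose F := truncation u D; have psF : bounded_psh D F by exact: truncation_bpsh.
pose G y := F (l *: y); pose D1 : set (Cn R n) := [set y | D (l *: y)].
have psG : bounded_psh D1 G by exact: bounded_psh_dilation.
have G01 := bpsh_bound psG.
have clD1 y : closure D y -> D1 y by move=> cy; exact: star_shaped_open_disc.
have nearD1 y : closure D y -> \forall x \near y, D1 x.
  move=> cy; apply: (@dilation_continuous R _ l y D).
  by apply: open_nbhs_nbhs; split => //; exact: clD1.
have [d d0 hd] := compact_thicken (compact_closure_bounded bndD) nearD1.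
apply/lee_addgt0Pr => e e0.
have nearA x : A x -> \forall y \near x, G y < -1 + e.
  move=> Ax; apply: (bpsh_usc psG); first exact/clD1/subA.
  by rewrite (le_lt_trans (coneA x l Ax l1))// ltrDl.
have [d' d0' hd'] := compact_thicken compA nearA.
(* 1 / k <= d keeps the relevant translates of [D] inside [D1], so that [S] is psh on [D]; k d' >= 1
   makes points beyond distance [d'] contribute at most -1. *)
pose k := d^-1 + d'^-1; have k0 : 0 < k by rewrite addr_gt0// invr_gt0.
have kd : k^-1 <= d by rewrite -[leRHS]invrK lef_pV2 ?posrE ?invr_gt0// lerDl invr_ge0 (ltW d0').
have kd' : 1 <= k * d'.
  by rewrite mulrDl mulVf ?(gt_eqF d0')// lerDr mulr_ge0 ?invr_ge0 ?(ltW d0) ?(ltW d0').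
pose S := sup_convolution k G; have S01 := sup_convolution_bound G01 (ltW k0).
have psS : bounded_psh D S.
  apply: (sup_convolution_psh G01 (ltW k0) psG k0) => x y Dx yx.
  by apply: (hd x) (le_trans yx kd); exact: subset_closure.
have cS : continuous S by apply: sup_convolution_continuous => //; exact: ltW.
pose w y := S y - e.
have cw : continuous w.
  move=> y; apply: (@cvgB _ _ _ (nbhs y) _ S (fun=> e)); first exact: (cS y).
  exact: cvg_cst.
have pw : psh_neg D (fun y => (w y)%:E).
  apply: continuous_psh_neg => //.
    by move=> y; rewrite /w subr_le0 (le_trans _ (ltW e0))//; have /andP[] := S01 y.
  move=> a b Dab; rewrite /w; have bm := bpsh_circle_measurable psS (disc_circle Dab).
  have bc : bounded_measurable 0 (2 * pi) (fun=> - e : R) by exact: bounded_measurable_cst.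
  by rewrite (cmeanD bm bc) cmean_cst lerD2r; exact: (@bpsh_mean _ _ _ _ psS a b Dab).
have wA x : A x -> w x <= -1.
  move=> Ax; suff : S x <= -1 + e by rewrite /w; lra.
  apply: (sup_convolution_local G01 (ltW k0) (d := d')); first by lra.
  by move=> y yx; apply/ltW/(hd' x).
have : ((w z)%:E <= omega_c A D z)%E.
  apply: ereal_sup_ubound; exists w => //; split => //.
  exact: continuous_subspaceT.
have := le_sup_convolution G01 (ltW k0) z; rewrite -/S => GS.
move=> h; rewrite (@le_trans _ _ ((w z)%:E + e%:E)%E) ?leeD2r//.
by rewrite -EFinD lee_fin /w subrK.
Qed.

Lemma le_omega_c z : D z ->
  (forall x (s : C), A x -> rnorm s < 1 -> truncation u D (s *: x) <= -1) ->
  (u z <= omega_c A D z)%E.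
Proof.
move=> Dz coneA; apply: (le_trans (le_truncation pu Dz)).
have H l : rnorm (l : C) < 1 -> ((truncation u D (l *: z))%:E <= omega_c A D z)%E.
  by move=> l1; exact: dilation_le_omega_c.
(* [bpsh_radial_le] takes a real bound; the value -oo contradicts [H] at l = 0, the truncation being
   finite. *)
move: H; case: (omega_c A D z) => [M H| |H]; last 2 first.
- by rewrite leey.
- by have := H 0; rewrite rnorm0 ltr01 => /(_ isT).
rewrite lee_fin; apply: (bpsh_radial_le (truncation_bpsh oD pu)) => //.
  by move=> l; exact: star_shaped_disc.
Qed.

(** The common reduction for radial and normal limits: one direction [v] per point [x], its
    rotations serving the rest of the orbit. *)
Lemma le_omega_c_of_limits z : circular A -> D z ->
  (forall x, A x -> exists (v : Cn R n) (e : R), [/\ 0 < e,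
     forall t : R, 0 < t < e -> D (x + (t%:C : C) *: v) &
     forall theta eta : R, 0 < eta -> exists2 d : R, 0 < d &
       forall t : R, 0 < t < d ->
         (u ((expi theta : C) *: (x + (t%:C : C) *: v)%R) <= (-1 + eta)%:E)%E]) ->
  (u z <= omega_c A D z)%E.
Proof.
move=> circA Dz lim; apply: le_omega_c => // x s Ax s1.
have [v [e [e0 Dt limx]]] := lim x Ax.
apply: (@bpsh_boundary_limit R _ D _ (truncation_bpsh oD pu) oD x v e s) => //.
- by move=> y l; exact: star_shaped_disc.
- move=> theta eta eta0; have [d d0 hd] := limx theta eta eta0.
  exists (Num.min d e); first by rewrite lt_min d0.
  move=> t; rewrite lt_min => /andP[t0 /andP[td te]].
  rewrite -lee_fin truncationE//.
    rewrite ge_max hd ?t0//= lee_fin; lra.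
  by apply: circD; apply: Dt; rewrite t0.
by apply: star_shaped_open_disc => //; exact: subA.
Qed.

End StarShapedDomains.

(** * Directional derivatives, the gradient and the inward normal *)

Section DirectionalDerivatives.
Variables (R : realType) (n : nat).
Implicit Types (U D : set (Cn R n)) (rho : Cn R n -> R) (z x v w : Cn R n).
Local Notation C := (R[i]^o).

Lemma ddir_is_derive v rho z : ddirable v rho z ->
  is_derive (0 : R) 1 (fun t : R => rho (z + (t%:C : C) *: v)) (ddir v rho z).
Proof. by move=> h; rewrite /ddir derive1E; exact: derivableP. Qed.

Lemma line_is_derive v rho z (t : R) : ddirable v rho (z + (t%:C : C) *: v) ->
  is_derive t 1 (fun s : R => rho (z + (s%:C : C) *: v)) (ddir v rho (z + (t%:C : C) *: v)).
Proof.
move=> /ddir_is_derive h.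
have -> : (fun s : R => rho (z + (s%:C : C) *: v)) =
    (fun s : R => rho (z + (t%:C : C) *: v + (s%:C : C) *: v)) \o (fun s => s - t).
  apply/funext => s /=.
  have sE : s%:C = t%:C + (s - t)%:C :> C by rewrite -rmorphD /= [t + _]addrC subrK.
  by rewrite sE scalerDl addrA.
have h2 : is_derive t 1 (fun s : R => s - t) 1.
  by apply: is_derive_eq; rewrite subr0.
have h3 : is_derive ((fun s => s - t) t) 1
    (fun s : R => rho (z + (t%:C : C) *: v + (s%:C : C) *: v))
    (ddir v rho (z + (t%:C : C) *: v)) by rewrite subrr.
have := @is_derive1_comp R _ _ t _ _ h3 h2; rewrite mulr1; exact.
Qed.

Lemma ddir_mean_value v rho z (t : R) :
  (forall c : R, `|c| <= `|t| -> ddirable v rho (z + (c%:C : C) *: v)) ->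
  exists2 c : R, `|c| <= `|t| &
    rho (z + (t%:C : C) *: v) - rho z = t * ddir v rho (z + (c%:C : C) *: v).
Proof.
move=> dd; set f := fun s : R => rho (z + (s%:C : C) *: v).
have f0 : f 0 = rho z by rewrite /f scale0r addr0.
have df (s : R) : `|s| <= `|t| -> is_derive s 1 f (ddir v rho (z + (s%:C : C) *: v)).
  by move=> /dd; exact: line_is_derive.
have cf (a b : R) : (forall s : R, a <= s <= b -> `|s| <= `|t|) -> {within `[a, b], continuous f}.
  move=> ab; apply: derivable_within_continuous => s; rewrite in_itv /= => /ab /df h.
  exact: ex_derive.
rewrite -f0; have [t0|t0] := leP 0 t.
  have H (s : R) : 0 <= s <= t -> `|s| <= `|t| by move=> /andP[s0 st]; rewrite !ger0_norm.
  have [s|c|c] := @MVT_segment R f (fun s => ddir v rho (z + (s%:C : C) *: v)) 0 t t0.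
  - by rewrite in_itv /= => /andP[s0 s1]; apply: df; apply: H; rewrite !ltW.
  - exact: cf.
  rewrite in_itv /= => /H ct; rewrite subr0 => ->; exists c => //; exact: mulrC.
have H (s : R) : t <= s <= 0 -> `|s| <= `|t|.
  by move=> /andP[s0 st]; rewrite ler0_norm// ltr0_norm// lerN2.
have [s|c|c] := @MVT_segment R f (fun s => ddir v rho (z + (s%:C : C) *: v)) t 0 (ltW t0).
- by rewrite in_itv /= => /andP[s0 s1]; apply: df; apply: H; rewrite !ltW.
- exact: cf.
rewrite in_itv /= => /H ct E; exists c => //.
by apply/eqP; rewrite -subr_eq0 -oppr_eq0 opprB -[f t - _]opprB E; apply/eqP; ring.
Qed.

Lemma ddir_eq v rho z (l : R) :
  (forall e : R, 0 < e -> exists2 d : R, 0 < d & forall h : R, h != 0 -> `|h| < d ->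
     `|rho (z + (h%:C : C) *: v) - rho z - h * l| <= e * `|h|) ->
  ddir v rho z = l.
Proof.
move=> H; rewrite /ddir derive1E /derive; apply: cvg_lim => //.
apply/cvgrPdist_le => e e0; have [d d0 hd] := H e e0.
exists d => // h /=; rewrite sub0r normrN => hlt h0.
have hE : h *: (1 : R) = h by exact: mulr1.
rewrite /= addr0 hE.
rewrite scale0r addr0 -(ler_pM2l (_ : 0 < `|h|)) ?normr_gt0// -normrM mulrBr.
rewrite [h * (_ *: _)]mulVKf// distrC [leRHS]mulrC; exact: hd.
Qed.

Section C1.
Variables (U : set (Cn R n)) (rho : Cn R n -> R).
Hypotheses (oU : open U) (C1 : of_class_C 1 U rho).

Lemma C1_ddirable v z : U z -> ddirable v rho z.
Proof. by case: C1 => _ /(_ v)[h _]; exact: h. Qed.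

Lemma C1_ddir_continuous v z : U z -> {for z, continuous (ddir v rho)}.
Proof. by case: C1 => _ /(_ v)[_ [h _]]; exact: h. Qed.

Lemma ddirZ (a : R) v z : U z -> ddir ((a%:C : C) *: v) rho z = a * ddir v rho z.
Proof.
move=> Uz; have h1 := ddir_is_derive (C1_ddirable (v := v) Uz).
rewrite {1}/ddir derive1E.
have -> : (fun t : R => rho (z + (t%:C : C) *: ((a%:C : C) *: v))) =
    (fun t : R => rho (z + (t%:C : C) *: v)) \o (fun t => a * t).
  by apply/funext => t /=; rewrite scalerA rmorphM mulrC.
have h2 : is_derive (0 : R) 1 (fun t : R => a * t) a.
  by apply: is_derive_eq; rewrite /GRing.scale /= mulr1.
rewrite -{1}(mulr0 a) in h1.
by have /@derive_val := @is_derive1_comp R _ _ 0 _ _ h1 h2; rewrite mulrC.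
Qed.

Lemma near_ddir v z (e : R) : U z -> 0 < e -> exists2 d : R, 0 < d &
  forall y, rnorm (y - z) < d -> U y /\ `|ddir v rho y - ddir v rho z| <= e.
Proof.
move=> Uz e0; have h1 : \forall y \near z, U y by exact: open_nbhs_nbhs.
have h2 : \forall y \near z, `|ddir v rho y - ddir v rho z| <= e.
  have /cvgrPdist_le/(_ e e0) := C1_ddir_continuous (v := v) Uz.
  by apply: filterS => y; rewrite distrC.
have : \forall y \near z, U y /\ `|ddir v rho y - ddir v rho z| <= e by exact: filterI.
by move=> /nbhs_rnormP.
Qed.

(** [of_class_C] controls each direction separately. Additivity follows from continuity: the
    increment along h (v + w) is split into the legs h v and h w, with the mean value theorem on
    each. *)
Lemma ddirD v w z : U z -> ddir (v + w) rho z = ddir v rho z + ddir w rho z.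
Proof.
move=> Uz; apply: ddir_eq => e e0.
have e2 : 0 < e / 2 by rewrite divr_gt0.
have [d1 d10 hd1] := near_ddir v Uz e2; have [d2 d20 hd2] := near_ddir w Uz e2.
pose K := rnorm v + rnorm w + 1.
have K0 : 0 < K by rewrite ltr_wpDl// addr_ge0// rnorm_ge0.
exists (Num.min d1 d2 / K); first by rewrite divr_gt0// lt_min d10.
move=> h h0 hK; rewrite ltr_pdivlMr// lt_min in hK; have /andP[K1 K2] := hK.
have nv := rnorm_ge0 v; have nw := rnorm_ge0 w.
have near c1 c2 : `|c1| <= `|h| -> `|c2| <= `|h| ->
    rnorm (z + (c1%:C : C) *: v + (c2%:C : C) *: w - z) <= `|h| * K.
  move=> c1h c2h.
  have -> : z + (c1%:C : C) *: v + (c2%:C : C) *: w - z =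
      (c1%:C : C) *: v + (c2%:C : C) *: w by rewrite -(addrA z) addrAC subrr add0r.
  rewrite (le_trans (rnormD _ _))// !rnormZ !rnorm_real /K.
  have := ler_wpM2r nv c1h; have := ler_wpM2r nw c2h; have := normr_ge0 h.
  by rewrite !mulrDr mulr1; lra.
have n1 (c : R) : `|c| <= `|h| -> rnorm (z + (c%:C : C) *: v - z) <= `|h| * K.
  move=> ch; have := near c 0 ch; rewrite normr0 => /(_ (normr_ge0 _)).
  by rewrite scale0r addr0.
have [c ch|c1 c1h E1] := @ddir_mean_value v rho z h.
  by apply: C1_ddirable; have [] := hd1 _ (le_lt_trans (n1 c ch) K1).
have [c ch|c2 c2h E2] := @ddir_mean_value w rho (z + (h%:C : C) *: v) h.
  by apply: C1_ddirable; have [] := hd1 _ (le_lt_trans (near h c (lexx _) ch) K1).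
have [_ b1] := hd1 _ (le_lt_trans (n1 c1 c1h) K1).
have [_ b2] := hd2 _ (le_lt_trans (near h c2 (lexx _) c2h) K2).
have -> : rho (z + (h%:C : C) *: (v + w)) - rho z - h * (ddir v rho z + ddir w rho z) =
    h * (ddir v rho (z + (c1%:C : C) *: v) - ddir v rho z) +
    h * (ddir w rho (z + (h%:C : C) *: v + (c2%:C : C) *: w) - ddir w rho z).
  have -> : rho (z + (h%:C : C) *: (v + w)) - rho z =
      (rho (z + (h%:C : C) *: v + (h%:C : C) *: w) - rho (z + (h%:C : C) *: v)) +
      (rho (z + (h%:C : C) *: v) - rho z) by rewrite subrKA scalerDr addrA.
  have alg (p q a b : R) : h * q + h * p - h * (a + b) = h * (p - a) + h * (q - b) by ring.
  by rewrite E1 E2; exact: alg.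
apply: (le_trans (ler_normD _ _)); rewrite !normrM.
apply: (le_trans (lerD (ler_wpM2l (normr_ge0 h) b1) (ler_wpM2l (normr_ge0 h) b2))).
by rewrite -mulrDr -splitr mulrC.
Qed.

Lemma ddir0 z : ddir 0 rho z = 0.
Proof.
apply: ddir_eq => e e0; exists 1 => // h _ _.
by rewrite scaler0 addr0 mulr0 subr0 subrr normr0 mulr_ge0// ltW.
Qed.

Lemma ddir_sum (I : Type) (s : seq I) (f : I -> Cn R n) z : U z ->
  ddir (\sum_(i <- s) f i) rho z = \sum_(i <- s) ddir (f i) rho z.
Proof.
move=> Uz; elim: s => [|i s IH]; first by rewrite !big_nil ddir0.
by rewrite !big_cons ddirD// IH.
Qed.

Lemma ddir_lin (l : C) v z : U z ->
  ddir (l *: v) rho z = complex.Re l * ddir v rho z + complex.Im l * ddir ('i *: v) rho z.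
Proof.
move=> Uz; have -> : l *: v =
    ((complex.Re l)%:C : C) *: v + ((complex.Im l)%:C : C) *: ('i *: v).
  by rewrite scalerA -scalerDl {1}(complexE l) [in RHS]mulrC.
by rewrite ddirD// !ddirZ.
Qed.

Lemma Re_grad z j : complex.Re (grad rho z 0 j) = ddir (delta_mx 0 j) rho z.
Proof. by rewrite /grad mxE. Qed.

Lemma Im_grad z j : complex.Im (grad rho z 0 j) = ddir ('i *: delta_mx 0 j) rho z.
Proof. by rewrite /grad mxE. Qed.

(** By linearity the derivative along the gradient is the sum of the squares of its real
    coordinates. *)
Lemma ddir_grad z : U z -> grad rho z != 0 -> 0 < ddir (grad rho z) rho z.
Proof.
move=> Uz g0.
have gE : grad rho z = \sum_j (grad rho z 0 j) *: delta_mx 0 j by exact: row_sum_delta.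
have dE : ddir (grad rho z) rho z =
    \sum_j ((complex.Re (grad rho z 0 j)) ^+ 2 + (complex.Im (grad rho z 0 j)) ^+ 2).
  rewrite {1}gE ddir_sum//; apply: eq_bigr => j _; rewrite ddir_lin//.
  by rewrite -Re_grad -Im_grad !expr2.
have [j gj] : exists j, grad rho z 0 j != 0.
  apply: contrapT => h; move/eqP: g0; apply; apply/rowP => j; rewrite [RHS]mxE.
  by apply/eqP; apply: contrapT => /negP hj; apply: h; exists j.
rewrite dE (bigD1 j)//= ltr_pwDl//; last first.
  by apply: sumr_ge0 => k _; rewrite addr_ge0// sqr_ge0.
rewrite lt_neqAle addr_ge0 ?sqr_ge0// andbT eq_sym paddr_eq0 ?sqr_ge0// !sqrf_eq0.
by apply: contra gj; case: (grad rho z 0 j) => a b /= /andP[/eqP -> /eqP ->].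
Qed.

(** Near [x] the derivative along the gradient stays above half of its value at [x], so that [rho]
    strictly decreases along the normal. For a defining function this places the start of the normal
    in [D]. *)
Lemma inward_normal_decrease x : U x -> rho x <= 0 -> grad rho x != 0 ->
  exists2 e : R, 0 < e & forall t : R, 0 < t < e ->
    U (x - (t%:C : C) *: grad rho x) /\ rho (x - (t%:C : C) *: grad rho x) < 0.
Proof.
move=> Ux rx g0; pose g := grad rho x; have gpos : 0 < ddir g rho x by exact: ddir_grad.
have g2 : 0 < ddir g rho x / 2 by rewrite divr_gt0.
have [d d0 hd] := near_ddir g Ux g2.
have k0 : 0 < rnorm g + 1 by rewrite ltr_wpDl// rnorm_ge0.
exists (d / (rnorm g + 1)); first by rewrite divr_gt0.
move=> t /andP[t0 td].
have near (c : R) : `|c| <= `|- t| -> rnorm (x + (c%:C : C) *: g - x) < d.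
  rewrite normrN (gtr0_norm t0) => ct; rewrite addrAC subrr add0r rnormZ rnorm_real.
  rewrite ltr_pdivlMr// in td; apply: le_lt_trans td.
  have := ler_wpM2r (rnorm_ge0 g) ct; rewrite mulrDr mulr1; lra.
have -> : x - (t%:C : C) *: grad rho x = x + ((- t)%:C : C) *: g.
  by rewrite rmorphN scaleNr.
split; first by have [] := hd _ (near _ (lexx _)).
have [c ch|c ch E] := @ddir_mean_value g rho x (- t).
  by apply: C1_ddirable; have [] := hd _ (near _ ch).
have [_ hc] := hd _ (near _ ch).
rewrite ler_norml in hc; have /andP[h1 _] := hc.
have : 0 < ddir g rho (x + (c%:C : C) *: g) by lra.
move=> /(mulr_gt0 t0); move: E; rewrite mulNr; lra.
Qed.

End C1.

End DirectionalDerivatives.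

Section Rotations.
Variables (R : realType) (n : nat).
Implicit Types (U D : set (Cn R n)) (rho : Cn R n -> R) (z x v w : Cn R n).
Local Notation C := (R[i]^o).

Lemma ddir_dilation (l : C) v rho :
  ddir v (fun y => rho (l *: y)) = fun y => ddir (l *: v) rho (l *: y).
Proof.
apply/funext => y; rewrite /ddir; congr (derive1 _ (0 : R)).
by apply/funext => t; rewrite scalerDr !scalerA [l * _]mulrC.
Qed.

Lemma ddirable_dilation (l : C) v rho z :
  ddirable v (fun y => rho (l *: y)) z = ddirable (l *: v) rho (l *: z).
Proof.
rewrite /ddirable (_ : (fun t : R => rho (l *: (z + (t%:C : C) *: v))) =
  (fun t : R => rho (l *: z + (t%:C : C) *: (l *: v))))//.
by apply/funext => t; rewrite scalerDr !scalerA [l * _]mulrC.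
Qed.

Lemma of_class_C_dilation (l : C) k U rho : of_class_C k U rho ->
  of_class_C k [set y | U (l *: y)] (fun y => rho (l *: y)).
Proof.
elim: k rho => [|k IH] rho [cU dU]; split => //.
- move=> z Uz; apply: (@continuous_comp _ _ _ (fun y : Cn R n => l *: y : Cn R n) rho z).
    exact: dilation_continuous.
  exact: cU.
- move=> z Uz; apply: (@continuous_comp _ _ _ (fun y : Cn R n => l *: y : Cn R n) rho z).
    exact: dilation_continuous.
  exact: cU.
move=> v; have [dv cv] := dU (l *: v); split.
  by move=> z Uz; rewrite ddirable_dilation; exact: dv.
by rewrite ddir_dilation; exact: IH.
Qed.

(** The adjoint of the rotation by -t is the rotation by t, whence the factor e^{it} outside. *)
Lemma grad_rotation (t : R) U rho z : open U -> of_class_C 1 U rho ->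
  U ((expi (- t) : C) *: z) ->
  grad (fun y => rho ((expi (- t) : C) *: y)) z =
  (expi t : C) *: grad rho ((expi (- t) : C) *: z).
Proof.
move=> oU C1 Uz; apply/rowP => j; rewrite !mxE !ddir_dilation.
set y := _ *: z in Uz *.
rewrite (ddir_lin oU C1 (expi (- t)) _ Uz) scalerA (ddir_lin oU C1 (expi (- t) * 'i) _ Uz).
move: (ddir _ rho y) (ddir _ rho y) => p q; rewrite /expi cosN sinN.
by apply/eqP; rewrite eq_complex /=; apply/andP; split; apply/eqP; ring.
Qed.

(** As [inward_normal] asks for some defining function, transporting one of them carries the normal
    at [x] into the normal at e^{it} x. *)
Lemma rotated_defining_function (t : R) D U rho x : circular D ->
  local_defining_function D x U rho ->
  local_defining_function D ((expi t : C) *: x) [set y | U ((expi (- t) : C) *: y)]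
    (fun y => rho ((expi (- t) : C) *: y)).
Proof.
move=> circD [oU Ux sm g0 DU]; have C1 := sm 1%N.
have rotK y : (expi (- t) : C) *: ((expi t : C) *: y) = y.
  by rewrite scalerA expiNK scale1r.
have rotVK y : (expi t : C) *: ((expi (- t) : C) *: y) = y.
  by rewrite scalerA [X in X *: _]mulrC expiNK scale1r.
split.
- apply: open_comp oU => y _; exact: dilation_continuous.
- by rewrite /= rotK.
- by move=> k; exact/of_class_C_dilation/sm.
- move=> y Uy; rewrite (grad_rotation oU C1 Uy) scaler_eq0 negb_or (g0 _ Uy) andbT.
  apply/eqP => h; have := rnorm_expi t; rewrite h rnorm0 => /eqP.
  by rewrite eq_sym oner_eq0.
apply/seteqP; split => [y [Dy Uy]|y [Uy ry]].
  have : (D `&` U) ((expi (- t) : C) *: y) by split => //; exact: circD.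
  by rewrite DU.
split => //; have : (D `&` U) ((expi (- t) : C) *: y) by rewrite DU.
by move=> [/(circD t) + _]; rewrite rotVK.
Qed.

End Rotations.

(** * Comparison of the four extremal functions *)

Section BoundaryLimits.
Variables (R : realType) (n : nat) (D A : set (Cn R n)).
Hypotheses (domD : domain D) (bndD : bounded_set D) (smoothD : smooth_boundary D)
    (circD : circular D) (starD : strongly_star_shaped D)
    (subA : A `<=` boundary D) (circA : circular A) (compA : compact A).
Local Notation C := (R[i]^o).
Local Open Scope ereal_scope.

Let clA : A `<=` closure D. Proof. by move=> x /subA[]. Qed.

Lemma omega_c_le_omega z : D z -> omega_c A D z <= omega A D z.
Proof.
move=> Dz; apply: ge_ereal_sup => _ [u [pu cu uA] <-].
apply: ereal_sup_ubound; exists (fun w => (u w)%:E) => //; split => // x Ax.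
apply/limsup_inP => e e0.
have : \forall y \near within (closure D) (nbhs x), (`|u x - u y| < e)%R.
  have /cvgrPdist_lt/(_ e e0) : u @ within (closure D) (nbhs x) --> u x.
    by have /(_ x) := cu; rewrite /continuous_at nbhs_subspace_in//; exact: clA.
  exact.
rewrite near_withinE => /nbhs_rnormP[d d0 hd]; exists d => // y Dy yx.
have := hd y yx (subset_closure Dy); have := uA x Ax.
by rewrite lee_fin ltr_norml => h1 /andP[h2 h3]; lra.
Qed.

Lemma omega_le_omega_n z : omega A D z <= omega_n A D z.
Proof.
apply: le_ereal_sup => _ [u [pu uA] <-]; exists u => //; split => // x Ax.
apply/limsup_inP => e e0; have [d d0 hd] := (limsup_inP _ _ _ _).1 (uA x Ax) e e0.
by exists d => // y [_ Dy]; exact: hd.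
Qed.

Lemma omega_le_omega_R z : omega A D z <= omega_R A D z.
Proof.
apply: le_ereal_sup => _ [u [pu uA] <-]; exists u => //; split => // x Ax.
apply: le_limf_esup => e e0; have [d d0 hd] := (limsup_inP _ _ _ _).1 (uA x Ax) e e0.
have k0 : (0 < rnorm x + 1)%R by rewrite ltr_wpDl// rnorm_ge0.
suff : \forall r \near (1 : R)^'-, u (((r : R)%:C : C) *: x) <= (-1 + e)%:E by [].
near=> r; have r1 : (r < 1)%R by near: r; exact: nbhs_left_lt.
have r2 : (1 - Num.min 1 (d / (rnorm x + 1)) < r)%R.
  by near: r; apply: nbhs_left_gt; rewrite ltrBlDr ltrDl lt_min ltr01 divr_gt0.
have r0 : (0 < r)%R.
  by apply: le_lt_trans r2; rewrite subr_ge0 ge_min lexx.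
have r3 : (1 - r < d / (rnorm x + 1))%R.
  rewrite ltrBlDr addrC -ltrBlDr; apply: le_lt_trans r2.
  by rewrite lerD2l lerN2 ge_min lexx orbT.
apply: hd; first by apply: starD; [rewrite r0|exact: clA].
have -> : ((r%:C : C) *: x - x = ((r - 1)%:C : C) *: x)%R.
  by rewrite rmorphB scalerBl scale1r.
rewrite rnormZ rnorm_real distrC ger0_norm ?subr_ge0 ?ltW//.
rewrite ltr_pdivlMr// in r3; apply: le_lt_trans r3.
by rewrite ler_wpM2l ?subr_ge0 ?(ltW r1)// lerDl.
Unshelve. all: by end_near. Qed.

Lemma omega_R_le_omega_c z : D z -> omega_R A D z <= omega_c A D z.
Proof.
move=> Dz; apply: ge_ereal_sup => _ [u [pu uA] <-].
apply: (le_omega_c_of_limits domD circD starD bndD clA compA pu circA Dz) => x Ax.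
(* With v = - x, x + t v is (1 - t) x: the radial approach. *)
exists (- x)%R, 1%R.
have tE (t : R) : (x + (t%:C : C) *: - x = ((1 - t)%:C : C) *: x)%R.
  by rewrite rmorphB scalerBl scale1r scalerN.
split => //.
  move=> t /andP[t0 t1]; rewrite tE; apply: starD; last exact: clA.
  by rewrite subr_gt0 t1 /= ltrBlDr ltrDl.
move=> theta eta eta0.
have [W [d /= d0 hd] Wu] := limf_esup_le eta0 (uA _ (circA theta Ax)).
exists d => // t /andP[t0 td]; rewrite tE.
have := Wu (1 - t)%R; rewrite !scalerA mulrC; apply; apply: hd.
  by rewrite /ball /= opprB addrC subrK gtr0_norm.
by rewrite ltrBlDr ltrDl.
Qed.

Lemma omega_n_le_omega_c z : D z -> omega_n A D z <= omega_c A D z.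
Proof.
move=> Dz; apply: ge_ereal_sup => _ [u [pu uA] <-].
apply: (le_omega_c_of_limits domD circD starD bndD clA compA pu circA Dz) => x Ax.
have [U [rho ldf]] := smoothD (subA Ax).
have [oU Ux sm g0 DU] := ldf; have C1 := sm 1%N.
(* Were [rho] positive at [x], it would be positive nearby, where [D] has points. *)
have rx : (rho x <= 0)%R.
  rewrite leNgt; apply/negP => rx.
  have h1 : \forall y \near x, U y by exact: open_nbhs_nbhs.
  have h2 : \forall y \near x, (0 < rho y)%R.
    by have [cr _] := C1; exact: (cvgr_gt _ (cr x Ux)).
  have [y [Dy [Uy ry]]] := clA Ax (filterI h1 h2).
  have : (D `&` U) y by [].
  by rewrite DU => -[_]; rewrite ltNge ltW.
have [e e0 he] := inward_normal_decrease oU C1 Ux rx (g0 x Ux).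
have Dt (t : R) : (0 < t < e)%R -> D (x + (t%:C : C) *: - grad rho x)%R.
  move=> /he; rewrite scalerN => h.
  have : [set w | U w /\ (rho w < 0)%R] (x - (t%:C : C) *: grad rho x)%R by [].
  by rewrite -DU => -[].
exists (- grad rho x)%R, e; split => // theta eta eta0.
have [d d0 hd] := (limsup_inP _ _ _ _).1 (uA _ (circA theta Ax)) eta eta0.
have k0 : (0 < rnorm (grad rho x) + 1)%R by rewrite ltr_wpDl// rnorm_ge0.
exists (Num.min e (d / (rnorm (grad rho x) + 1)))%R; first by rewrite lt_min e0 divr_gt0.
move=> t; rewrite lt_min => /andP[t0 /andP[te td]]; apply: hd; last first.
  have -> : ((expi theta : C) *: (x + (t%:C : C) *: - grad rho x) - (expi theta : C) *: x =
      (expi theta : C) *: ((t%:C : C) *: - grad rho x))%R.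
    by rewrite scalerDr addrAC subrr add0r.
  rewrite !rnormZ rnorm_expi mul1r rnorm_real gtr0_norm// rnormN.
  rewrite ltr_pdivlMr// in td; apply: le_lt_trans td.
  by rewrite ler_wpM2l ?(ltW t0)// lerDl.
split; last by apply: circD; apply: Dt; rewrite t0.
(* The rotated defining function witnesses that the rotated point lies on the normal at e^{i theta}
   x, with the same parameter [t]. *)
exists [set y | U ((expi (- theta) : C) *: y)], (fun y => rho ((expi (- theta) : C) *: y)), t.
split => //; first exact: rotated_defining_function.
have E : ((expi (- theta) : C) *: ((expi theta : C) *: x) = x)%R.
  by rewrite scalerA expiNK scale1r.
rewrite (grad_rotation oU C1); last by rewrite E.
by rewrite E scalerDr !scalerN !scalerA [(expi theta * _)%R]mulrC.
Qed.

End BoundaryLimits.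

Theorem theorem4p1 (R : realType) (n : nat) (D A : set (Cn R n))
    (domD : domain D) (bndD : bounded_set D) (smoothD : smooth_boundary D)
    (circD : circular D) (starD : strongly_star_shaped D)
    (subA : A `<=` boundary D) (circA : circular A) (compA : compact A) :
  (forall z, D z -> (omega_n A D z <= omega_R A D z)%E /\
                    omega_R A D z = omega_c A D z) /\
  (forall z, D z -> omega_c A D z = omega A D z /\
                    omega A D z = omega_n A D z).
Proof.
have c_le z (Dz : D z) := omega_c_le_omega subA Dz.
have le_n z := @omega_le_omega_n R n D A z.
have le_R z := omega_le_omega_R starD subA z.
have R_le z (Dz : D z) := omega_R_le_omega_c domD bndD circD starD subA circA compA Dz.
have n_le z (Dz : D z) :=
  omega_n_le_omega_c domD bndD smoothD circD starD subA circA compA Dz.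
have RE z : D z -> omega_R A D z = omega_c A D z.
  by move=> Dz; apply/eqP; rewrite eq_le R_le//= (le_trans (c_le z Dz)).
split=> z Dz; first by rewrite RE// n_le.
split; apply/eqP; rewrite eq_le; apply/andP; split.
- exact: c_le.
- by rewrite (le_trans (le_n z))// n_le.
- exact: le_n.
- by rewrite (le_trans (n_le z Dz))// c_le.
Qed.
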